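(* Let $A$ be a unital commutative $C^*$-algebra with Gelfand spectrum $\Delta(A)$. Then $$\mathrm{GC}_{C^*}(A)=\{\kappa\le |C(\Delta(A))| : \kappa \text{ is a nonzero cardinal and there exists an embedding } \Phi\colon\Delta(A)\to\mathbb{R}^\kappa\}.$$ In particular, $$\mathrm{gen}_{C^*}(A)=\min\{\kappa\le |C(\Delta(A))| : \kappa \text{ is a nonzero cardinal and there exists an embedding } \Phi\colon\Delta(A)\to\mathbb{R}^\kappa\}.$$
   Context: $\Delta(A)$ is the set of nonzero multiplicative linear functionals on $A$ with the weak$^*$-topology; $C(\Delta(A))$ is the algebra of continuous complex functions on it and $|C(\Delta(A))|$ its cardinality. $\mathbb{R}^\kappa$ carries the product topology, and an embedding is a homeomorphism onto its image. For a nonempty set $S\subseteq A$, $A(S)$ denotes the linear span of all finite products $s_1\cdots s_n$ ($n\ge 1$, $s_i\in S$). A nonempty set $S\subseteq A_{sa}=\{a\in A: a=a^*\}$ generates $A$ as a $C^*$-algebra if $\overline{A(S)}=A$ (only generating sets of self-adjoint elements are considered). $\mathrm{GC}_{C^*}(A)$ is the set of cardinals $|S|$, where $S$ runs over all sets generating $A$ as a $C^*$-algebra, and $\mathrm{gen}_{C^*}(A)=\min \mathrm{GC}_{C^*}(A)$. *)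

(* Defs.v *)
From HB Require Import structures.
From mathcomp Require Import all_boot all_order all_algebra.
From mathcomp Require Import complex.
From mathcomp Require Import all_classical all_reals all_analysis.

Set Implicit Arguments.
Unset Strict Implicit.
Unset Printing Implicit Defensive.

Import Order.TTheory GRing.Theory Num.Theory.
Import numFieldNormedType.Exports.

Local Open Scope classical_set_scope.
Local Open Scope ring_scope.
Local Open Scope card_scope.
Local Open Scope complex_scope.

(* Stated at the structure level so that the normed topology that the library
   puts on any [numClosedFieldType] applies; [R[i]] itself carries no topology. *)
Definition Cplx (R : realType) : numClosedFieldType := R[i].

(* Unital complex C*-algebras; the norm takes its values in [Cplx R].
   The multiplication is part of the mixin instead of being inherited from
   [GRing.PzRing]: the only join of rings and normed modules in the hierarchy is
   [Num.NumDomain], so Hierarchy Builder rejects a structure extending both.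
   [cstar_one] may be [0], i.e. the zero algebra (whose spectrum is empty) is
   included. *)
HB.mixin Record isCStarAlgebra (R : realType) A
    of CompleteNormedModule (Cplx R) A := {
  cstar_one : A;
  cstar_mul : A -> A -> A;
  cstar_star : A -> A;
  cstar_mulA : associative cstar_mul;
  cstar_mul1l : left_id cstar_one cstar_mul;
  cstar_mul1r : right_id cstar_one cstar_mul;
  cstar_mulDl : left_distributive cstar_mul +%R;
  cstar_mulDr : right_distributive cstar_mul +%R;
  cstar_scaleAl : forall (c : Cplx R) (x y : A),
    c *: cstar_mul x y = cstar_mul (c *: x) y;
  cstar_scaleAr : forall (c : Cplx R) (x y : A),
    c *: cstar_mul x y = cstar_mul x (c *: y);
  cstar_ler_normM : forall x y : A, `|cstar_mul x y| <= `|x| * `|y|;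
  cstar_starK : involutive cstar_star;
  cstar_starD : {morph cstar_star : x y / x + y};
  cstar_starZ : forall (c : Cplx R) (x : A),
    cstar_star (c *: x) = Num.conj c *: cstar_star x;
  cstar_starM : forall x y : A,
    cstar_star (cstar_mul x y) = cstar_mul (cstar_star y) (cstar_star x);
  cstar_normE : forall x : A, `|cstar_mul (cstar_star x) x| = `|x| ^+ 2
}.

#[short(type="cstarAlgType")]
HB.structure Definition CStarAlgebra (R : realType) :=
  {A of CompleteNormedModule (Cplx R) A & isCStarAlgebra R A}.

HB.mixin Record CStarAlgebra_isCommutative (R : realType) A
    of CStarAlgebra R A := {
  cstar_mulC : commutative (cstar_mul : A -> A -> A)
}.

#[short(type="comCstarAlgType")]
HB.structure Definition ComCStarAlgebra (R : realType) :=
  {A of CStarAlgebra R A & CStarAlgebra_isCommutative R A}.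

(* A cardinal is the class of all types equipotent to a given set. *)
Record cardinal := Cardinal {
  equipotent_class : Type -> Prop;
  equipotent_classP : exists (T : Type) (X : set T),
    equipotent_class = fun K : Type => [set: K] #= X
}.

Definition cardinality T (X : set T) : cardinal :=
  Cardinal (ex_intro _ T (ex_intro _ X erefl)).

Lemma eq_cardinality T U (X : set T) (Y : set U) :
  cardinality X = cardinality Y <-> X #= Y.
Proof.
split=> [/(congr1 equipotent_class)/= | XY].
  move=> /(congr1 (fun f => f (set_type X)))/= eXY.
  have {}eXY : [set: X] #= Y by rewrite -eXY; exact: card_setT.
  exact: card_eq_trans (card_setT_sym X) eXY.
rewrite /cardinality; set pX := ex_intro _ T _; set pY := ex_intro _ U _.
have eXY : (fun K : Type => [set: K] #= X : Prop) =
     (fun K : Type => [set: K] #= Y : Prop).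
  by apply/funext => K; rewrite (card_eqr XY).
by move: pX; rewrite eXY => pX; congr Cardinal; exact: Prop_irrelevance.
Qed.

Definition cardinal_le (k l : cardinal) : Prop :=
  exists K L : Type,
    [/\ k = cardinality [set: K], l = cardinality [set: L] &
        [set: K] #<= [set: L]].

Definition is_least (P : cardinal -> Prop) (k : cardinal) : Prop :=
  P k /\ forall l, P l -> cardinal_le k l.

Lemma is_least_uniq (P : cardinal -> Prop) (k l : cardinal) :
  is_least P k -> is_least P l -> k = l.
Proof.
move=> [Pk kmin] [Pl lmin].
have [K [L [kE lE KL]]] := kmin _ Pl.
have [L' [K' [lE' kE' LK']]] := lmin _ Pk.
have KK : [set: K'] #= [set: K] by apply/eq_cardinality; rewrite -kE' -kE.
have LL : [set: L'] #= [set: L] by apply/eq_cardinality; rewrite -lE' -lE.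
rewrite kE lE eq_cardinality card_eq_le KL /=.
by rewrite -(card_le_eqr KK) -(card_le_eql LL).
Qed.

(* A junk value if there is no least element. *)
Definition min_cardinal (P : cardinal -> Prop) : cardinal :=
  if pselect (exists k, is_least P k) is left e then projT1 (cid e)
  else cardinality (@set0 unit).

Section generators.
Context {R : realType} {A : cstarAlgType R}.

Definition products (S : set A) : set A :=
  [set x | exists (n : nat) (s : 'I_n.+1 -> A),
     (forall i, S (s i)) /\ x = \big[cstar_mul/cstar_one]_(i < n.+1) s i].

Definition linear_span (X : set A) : set A :=
  [set x | exists (n : nat) (c : 'I_n -> Cplx R) (v : 'I_n -> A),
     (forall i, X (v i)) /\ x = \sum_(i < n) c i *: v i].

Definition self_adjoint : set A := [set a | cstar_star a = a].

Definition generates (S : set A) : Prop :=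
  [/\ S !=set0, S `<=` self_adjoint &
      closure (linear_span (products S)) = [set: A]].

End generators.

Definition GC (R : realType) (A : cstarAlgType R) : cardinal -> Prop :=
  fun k => exists S : set A, generates S /\ k = cardinality S.

Definition gen (R : realType) (A : cstarAlgType R) : cardinal :=
  min_cardinal (GC A).

(* The subspace topology inherited from [{ptws A -> Cplx R}], the topology of
   pointwise convergence, is the weak* topology. *)
Definition spectrum (R : realType) (A : cstarAlgType R) :
    set {ptws A -> Cplx R} :=
  [set phi | [/\ scalar (phi : A -> Cplx R),
                 forall x y, phi (cstar_mul x y) = phi x * phi y &
                 exists x, phi x != 0]].

Arguments spectrum {R} A _.

Definition homeomorphism (T U : topologicalType) (h : T -> U) : Prop :=
  continuous h /\ exists g : U -> T, [/\ continuous g, cancel h g & cancel g h].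

Definition embedding (T U : topologicalType) (f : T -> U) : Prop :=
  exists h : T -> set_type (range f),
    (forall x, set_val (h x) = f x) /\ homeomorphism h.

Definition embedding_cardinals (R : realType) (A : cstarAlgType R) :
    cardinal -> Prop :=
  fun k => exists K : Type,
    [/\ k = cardinality [set: K],
        [set: K] !=set0,
        [set: K] #<= [set f : spectrum A -> Cplx R | continuous f] &
        exists Phi : spectrum A -> {ptws K -> R}, embedding Phi].

(* Main.v *)
Require Import Defs.
From HB Require Import structures.
From mathcomp Require Import all_boot all_order all_algebra.
From mathcomp Require Import complex.
From mathcomp Require Import ring lra.
From mathcomp Require Import all_classical all_reals all_analysis.

(** Write [D] for the spectrum of [A] and [hat a] for the function
    [phi |-> phi a] on [D].

    If a set [S] of self-adjoint elements generates [A], then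
    [phi |-> (phi s)_(s in S)] maps [D] to a real power, because characters are
    real on self-adjoint elements ([character_real]); it is injective, because
    characters are contractions and hence determined by their values on [S]; and
    it is an embedding, because [D] is compact ([spectrum_compact],
    [compact_embedding]). Moreover [s |-> hat s] is injective, which bounds the
    cardinal of [S] by that of [C(D)] ([generating_set_embedding]).

    Conversely, the coordinates of an embedding of [D] into the [K]-th power of
    the reals are continuous real functions separating the points of [D]. By
    Gelfand duality each of them is [hat a] for a unique self-adjoint [a], and by
    the Stone-Weierstrass theorem ([stone_weierstrass]) the elements obtained
    generate [A], provided they do not all vanish at a common character: [A(S)]
    is spanned by nonempty products, so the unit has to be reached as well. It
    remains to turn the [K] coordinates into exactly [#|K|] distinct functions
    with no common zero ([separating_family]). For finite [K], adding distinct
    constants does it. For infinite [K], one throws in the constant [1] and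
    [#|K|] further functions. This is where the bound [#|K| <= #|C(D)|] enters,
    through the idempotence of infinite cardinals ([square_injects]), which
    gives [#|C(D)| = #|C(D, R)|]. When [D] is empty, [A] is zero and both sides
    are reduced to the cardinal one.

    Gelfand duality rests on the fact that a self-adjoint [a] is not smaller in
    norm than [hat a] ([self_adjoint_norm_le]). Both this and the Gelfand-Mazur
    theorem, used to turn maximal ideals into characters
    ([maximal_ideal_character]), are instances of one statement on the
    resolvent of an element whose powers [b ^ 2 ^ k] do not tend to zero
    ([resolvent_singular]). Its proof is elementary: averaging
    [(1 - c b)^-1] over the two square roots [c] of a given number yields the
    resolvent of [b ^ 2], so that any uniform estimate on the unit circle is
    inherited by all the powers [b ^ 2 ^ k].

    The minimum exists because any nonempty family of cardinals has a least
    member ([least_type_exists]). *)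

Set Implicit Arguments.
Unset Strict Implicit.
Unset Printing Implicit Defensive.

Import Order.TTheory GRing.Theory Num.Theory.
Import numFieldNormedType.Exports.

Local Open Scope classical_set_scope.
Local Open Scope ring_scope.
Local Open Scope card_scope.

(** * Comparison and idempotence of cardinals *)

Lemma card_le_injP T U (A : set T) (B : set U) :
  A #<= B <-> exists f : A -> B, injective f.
Proof.
split=> [/card_leP/injfunPex[f _ finj]|[f finj]].
  by exists f => x y; apply: finj; rewrite inE.
by apply/card_leP/injfunPex; exists f => // x y _ _; exact: finj.
Qed.

Lemma card_leTT_injP T U :
  [set: T] #<= [set: U] <-> exists f : T -> U, injective f.
Proof.
split=> [/card_le_injP[f finj]|[f finj]].
  exists (fun x => set_val (f (SigSub (mem_set (I : [set: T] x))))).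
  by move=> x y /val_inj /finj [].
apply/card_le_injP.
exists (fun x => SigSub (mem_set (I : [set: U] (f (set_val x))))).
by move=> x y [] /finj /val_inj.
Qed.

(** Take a maximal set [Z] of points of the product of the [T i] on which all the
    coordinate maps are injective. Some coordinate map sends [Z] onto [T i], since
    otherwise a point avoiding the image of [Z] in every coordinate could be
    added; going back to [Z] along it and projecting injects [T i] into any other
    [T j]. *)
Lemma least_type_exists (I : Type) (T : I -> Type) :
  inhabited I -> exists i, forall j, exists f : T i -> T j, injective f.
Proof.
move=> [i0].
pose P (Z : set (forall i, T i)) :=
  forall u v i, Z u -> Z v -> u i = v i -> u = v.
have [Z [PZ Zmax]] : exists Z, P Z /\ forall B, Z `<` B -> ~ P B.
  apply: Zorn_bigcup => F FP Ftot u v i [Z FZ Zu] [W FW Wv].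
  have [ZW|WZ] := Ftot _ _ FZ FW; first by apply: (FP _ FW) => //; exact: ZW.
  by apply: (FP _ FZ) => //; exact: WZ.
have [i iP] : exists i, forall x : T i, exists2 u, Z u & u i = x.
  apply: contrapT => /forallNP noi.
  have covN i : exists x : T i, ~ exists2 u, Z u & u i = x.
    exact/existsNP/noi.
  pose w i := sval (cid (covN i)).
  have wP u i : Z u -> u i = w i -> False.
    by move=> Zu uw; have := svalP (cid (covN i)); apply; exists u.
  apply: (Zmax (Z `|` [set w])).
    split=> [|ZwZ]; first by move=> u; left.
    by apply: (wP w i0) => //; apply: ZwZ; right.
  move=> u v i [Zu|->] [Zv|->] // uv; first exact: PZ Zu Zv uv.
  - by case: (wP u i).
  - by case: (wP v i).
have /choice[g gP] x : exists u, Z u /\ u i = x.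
  by have [u] := iP x; exists u.
exists i => j; exists (fun x => g x j) => x y gxy.
have [[Zx <-] [Zy <-]] := (gP x, gP y).
by congr (_ i); exact: PZ Zx Zy gxy.
Qed.

Lemma injection_total T U :
  (exists f : T -> U, injective f) \/ (exists f : U -> T, injective f).
Proof.
have [[] inj] := @least_type_exists bool (fun b => if b then T else U)
  (inhabits true); [left; exact: (inj false)|right; exact: (inj true)].
Qed.

Lemma sub_injection_total T (A B : set T) (f : A -> B) : injective f ->
  exists k : T -> T, (forall x, A x -> B (k x)) /\
    (forall x y, A x -> A y -> k x = k y -> x = y).
Proof.
move=> finj.
exists (fun x => if pselect (A x) is left Ax
  then set_val (f (SigSub (mem_set Ax))) else x).
split=> [x Ax|x y Ax Ay]; case: pselect => // Ax'; first exact: set_valP.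
by case: pselect => // Ay' /val_inj/finj [].
Qed.

(** For the graph of a map [D * D -> D], this is [D]. *)
Definition diagonal_domain T (G : set (T * T * T)) : set T :=
  [set x | exists z, G (x, x, z)].

(** The subsets [D] of [T] with an injection [D * D -> D] are handled through
    the graphs of these injections, because graphs are ordered by mere
    inclusion, as Zorn's lemma wants. *)
Definition square_injection T (G : set (T * T * T)) : Prop :=
  [/\ forall p p' z, G (p, z) -> G (p', z) -> p = p',
      forall p z z', G (p, z) -> G (p, z') -> z = z',
      forall x y z, G (x, y, z) -> [/\ diagonal_domain G x,
        diagonal_domain G y & diagonal_domain G z] &
      forall x y, diagonal_domain G x -> diagonal_domain G y ->
        exists z, G (x, y, z)].

Lemma square_injection_bigcup T (F : set (set (T * T * T))) :
  F `<=` @square_injection T -> total_on F subset ->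
  square_injection (\bigcup_(G in F) G).
Proof.
move=> FP Ftot.
have sub2 G H : F G -> F H -> exists K, [/\ F K, G `<=` K & H `<=` K].
  by move=> FG FH; have [GH|HG] := Ftot _ _ FG FH; [exists H|exists G]; split.
split.
- move=> p p' z [G FG Gz] [H FH Hz]; have [K [FK GK HK]] := sub2 _ _ FG FH.
  by have [inj _ _ _] := FP _ FK; exact: inj (GK _ Gz) (HK _ Hz).
- move=> p z z' [G FG Gz] [H FH Hz]; have [K [FK GK HK]] := sub2 _ _ FG FH.
  by have [_ fn _ _] := FP _ FK; exact: fn (GK _ Gz) (HK _ Hz).
- move=> x y z [G FG Gxyz]; have [_ _ dom _] := FP _ FG.
  have [[a Ga] [b Gb] [c Gc]] := dom _ _ _ Gxyz.
  by split; [exists a|exists b|exists c]; exists G.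
- move=> x y [a [G FG Ga]] [b [H FH Hb]].
  have [K [FK GK HK]] := sub2 _ _ FG FH; have [_ _ _ tot] := FP _ FK.
  have [||z Kz] := tot x y; [by exists a; exact: GK|by exists b; exact: HK|].
  by exists z, K.
Qed.

Lemma square_injection_nat T (e : nat -> T) : injective e ->
  exists2 G : set (T * T * T), square_injection G &
    forall n, diagonal_domain G (e n).
Proof.
move=> einj.
have /card_eqPle[/card_leTT_injP[c cinj] _] := card_nat2.
pose G := [set q : T * T * T |
  exists m n, q = (e m, e n, e (c (m, n)))].
have eG n : diagonal_domain G (e n) by exists (e (c (n, n))), n, n.
exists G => //; split.
- move=> p p' z [m [n [-> ->]]] [m' [n' [-> /einj/cinj[-> ->]]]] //.
- by move=> p z z' [m [n [-> ->]]] [m' [n' [/einj<- /einj<- ->]]].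
- by move=> x y z [m [n [-> -> ->]]].
- by move=> x y [_ [m [_ [-> _ _]]]] [_ [n [_ [-> _ _]]]];
  exists (e (c (m, n))), m, n.
Qed.

Lemma square_injection_fun T (G : set (T * T * T)) : square_injection G ->
  exists2 g : T -> T -> T,
    (forall x y, diagonal_domain G x -> diagonal_domain G y -> G (x, y, g x y)) &
    (forall x y x' y', diagonal_domain G x -> diagonal_domain G y ->
      diagonal_domain G x' -> diagonal_domain G y' ->
      g x y = g x' y' -> x = x' /\ y = y').
Proof.
move=> [Ginj _ _ Gtot].
have /choice[g gP] (p : T * T) : exists z,
    diagonal_domain G p.1 -> diagonal_domain G p.2 -> G (p, z).
  have [[p1 p2]|np] := pselect (diagonal_domain G p.1 /\ diagonal_domain G p.2).
    case: p p1 p2 => x y p1 p2; have [z Gz] := Gtot _ _ p1 p2; by exists z.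
  by exists p.1 => p1 p2; case: np.
exists (fun x y => g (x, y)) => [x y Gx Gy|x y x' y' Gx Gy Gx' Gy' gxy].
  exact: gP.
have Gg := gP (x, y) Gx Gy; have := gP (x', y') Gx' Gy'.
by rewrite -gxy => /(Ginj _ _ _ Gg) [].
Qed.

(** Let [g] be a maximal injection [D * D -> D] extending one of a countable set.
    If the complement of [D] injects into [D], then [T] does, as [D] holds two
    disjoint copies of itself; so does [T * T] into [D]. Otherwise the complement
    contains a copy [h D] of [D]. With [E] the union of [D] and [h D], the pairs
    in [E * E] but not in [D * D] can be sent to [h D], contradicting
    maximality. *)
Theorem square_injects T : infinite_set [set: T] ->
  exists f : T * T -> T, injective f.
Proof.
move=> /infiniteP/card_leTT_injP[e einj].
have [G0 sqG0 eG0] := square_injection_nat einj.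
pose P G := square_injection G /\ (G = set0 \/ G0 `<=` G).
have [G [[sqG GG0] Gmax]] : exists G, P G /\ forall B, G `<` B -> ~ P B.
  apply: Zorn_bigcup => F FP Ftot; split.
    by apply: square_injection_bigcup => // G /FP[].
  have [[G FG G0G]|nG] := pselect (exists2 G, F G & G0 `<=` G).
    by right=> p /G0G Gp; exists G.
  left; rewrite -subset0 => p [G FG Gp]; have [_ [G0' | ]] := FP _ FG.
    by rewrite G0' in Gp.
  by move=> G0G; apply: nG; exists G.
have {}GG0 : G0 `<=` G.
  case: GG0 => // G_0; case: (Gmax G0); last by split=> //; right.
  rewrite G_0; split=> // G00; have [z Gz] := eG0 0%N.
  exact: G00 Gz.
pose D := diagonal_domain G.
have De n : D (e n).
  by have [z Gz] := eG0 n; exists z; exact: GG0.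
have [g Gg ginj] := square_injection_fun sqG.
have Dg x y : D x -> D y -> D (g x y).
  by move=> Dx Dy; have [_ _ dom _] := sqG; have [] := dom _ _ _ (Gg _ _ Dx Dy).
(* Two disjoint copies of [D] fit into [D], as [D] has two distinct points. *)
have double (E : set T) (k : T -> T) :
    (forall x, E x -> ~ D x -> D (k x)) ->
    (forall x y, E x -> E y -> ~ D x -> ~ D y -> k x = k y -> x = y) ->
    exists c : T -> T, (forall x, E x -> D (c x)) /\
      (forall x y, E x -> E y -> c x = c y -> x = y).
  move=> kD kinj.
  exists (fun x => if pselect (D x) then g x (e 0%N) else g (k x) (e 1%N)).
  split=> [x Ex|x y Ex Ey]; first by case: pselect => Dx; apply: Dg; auto.
  have e01 : e 0%N <> e 1%N by move=> /einj.
  have kDx := kD _ Ex; have kDy := kD _ Ey.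
  case: pselect => Dx; case: pselect => Dy gxy.
  - by have [] := ginj _ _ _ _ Dx (De _) Dy (De _) gxy.
  - by have [_ /e01] := ginj _ _ _ _ Dx (De _) (kDy Dy) (De _) gxy.
  - by have [_ /esym/e01] := ginj _ _ _ _ (kDx Dx) (De _) Dy (De _) gxy.
  - have [+ _] := ginj _ _ _ _ (kDx Dx) (De _) (kDy Dy) (De _) gxy.
    exact: kinj.
have [[k kinj]|[h hinj]] := injection_total (~` D) D.
  have [k' [k'D k'inj]] := sub_injection_total kinj.
  have [||c [cD cinj]] := double setT k'.
  - by move=> x _; exact: k'D.
  - by move=> x y _ _; exact: k'inj.
  - exists (fun p => g (c p.1) (c p.2)) => -[x y] [x' y'] /= /ginj [||||].
    1-4: exact: cD.
    by move=> /cinj-> // /cinj->.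
have [h' [h'N h'inj]] := sub_injection_total hinj.
pose E := D `|` h' @` D.
have [k kP] : exists k : T -> T, forall y, (h' @` D) y -> D (k y) /\ h' (k y) = y.
  have /choice[k kP] : forall y, exists x, (h' @` D) y -> D x /\ h' x = y.
    move=> y; have [[x Dx <-]|ny] := pselect ((h' @` D) y); first by exists x.
    by exists y.
  by exists k.
have [x Ex nDx|x y Ex Ey nDx nDy|c [cD cinj]] := double E k.
- by case: Ex => // /kP[].
- case: Ex => // /kP[_ {2}<-]; case: Ey => // /kP[_ {2}<-] ->//.
pose code x y := g (c x) (c y).
have codeD x y : E x -> E y -> D (code x y) by move=> Ex Ey; apply: Dg; exact: cD.
have codeinj x y x' y' : E x -> E y -> E x' -> E y' ->
    code x y = code x' y' -> (x, y) = (x', y').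
  move=> Ex Ey Ex' Ey' /ginj[]; try exact: cD.
  by move=> /cinj-> // /cinj->.
pose H : set (T * T * T) := [set q | exists x y,
  [/\ E x, E y, ~ (D x /\ D y) & q = (x, y, h' (code x y))]].
have GHD : diagonal_domain (G `|` H) = E.
  rewrite predeqE => x; split=> [[z [Gx|[_ [y [Ex Ey _ [-> _ _]]]]]]|] //.
    by left; exists z.
  case=> [[z Gz]|[y Dy <-]]; first by exists z; left.
  exists (h' (code (h' y) (h' y))); right; exists (h' y), (h' y).
  have Ehy : E (h' y) by right; exists y.
  by split => // -[Dhy _]; exact: (h'N y Dy).
have [Ginj Gfn Gdom Gtot] := sqG.
case: (Gmax (G `|` H)).
  split; first by move=> p; left.
  move=> GHG; apply: (h'N _ (De 0%N)).
  suff : E (h' (e 0%N)) by rewrite -GHD => -[z /GHG Gz]; exists z.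
  by right; exists (e 0%N).
split; last by right=> p /GG0; left.
split.
- move=> p p' z [Gp|[x [y [Ex Ey nD [-> ->]]]]] [Gp'|[x' [y' [Ex' Ey' nD']]]].
  + exact: (Ginj _ _ _ Gp Gp').
  + case=> _ zE; case: p Gp => a b /Gdom[_ _]; rewrite zE => Dh.
    by case: (h'N _ _ Dh); exact: codeD.
  + by case: p' Gp' => a b /Gdom[_ _ Dh]; case: (h'N _ _ Dh); exact: codeD.
  + case=> -> /h'inj hh; apply: codeinj => //; apply: hh; exact: codeD.
- move=> p z z' [Gp|[x [y [Ex Ey nD [-> ->]]]]] [Gp'|[x' [y' [Ex' Ey' nD']]]].
  + exact: (Gfn _ _ _ Gp Gp').
  + by case=> pE _; rewrite pE in Gp; case: nD'; have [] := Gdom _ _ _ Gp.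
  + by case: nD; have [] := Gdom _ _ _ Gp'.
  + by case=> -> -> ->.
- move=> x y z; rewrite GHD => -[/Gdom[? ? ?]|]; first by split; left.
  move=> [x' [y' [Ex' Ey' _ [-> -> ->]]]]; split=> //.
  by right; exists (code x' y') => //; exact: codeD.
- move=> x y; rewrite GHD => Ex Ey.
  have [[Dx Dy]|nD] := pselect (D x /\ D y).
    by have [z Gz] := Gtot _ _ Dx Dy; exists z; left.
  by exists (h' (code x y)); right; exists x, y.
Qed.

(** * The Stone-Weierstrass theorem *)

Lemma continuous_compact_bounded (X : topologicalType) (R : realType)
    (f : X -> R) : compact [set: X] -> continuous f ->
  exists2 M : R, 0 < M & forall x, `|f x| <= M.
Proof.
move=> /compact_near_coveringP cX fc.
have [x _|M [_ MP]] := cX R (pinfty_nbhs R) (fun M x => `|f x| <= M) _.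
  have fx : \forall x' \near x, `|f x'| < `|f x| + 1.
    by apply: (cvgr_norm_lt _ (fc x)); rewrite ltrDl.
  exists ([set x' | `|f x'| < `|f x| + 1], [set M | `|f x| + 1 <= M]).
    by split=> //=; exact: nbhs_pinfty_ge.
  by move=> [x' M] [/= fx' fM]; exact/ltW/(lt_le_trans fx').
exists (`|M| + 1) => [|x]; first by rewrite ltr_wpDl.
by apply: MP => //; rewrite (le_lt_trans (ler_norm _))// ltrDl.
Qed.

(** As [L] is closed under minima, the sets of members of [L] lying below a given
    one form a filter base, and the compactness of [X] extends a bound that holds
    locally near each point for all small members of [L] to the whole of [X]. *)
Lemma min_closed_lt (X : topologicalType) (R : realType) (L : set (X -> R))
    (u : X -> R) : compact [set: X] -> continuous u ->
  L !=set0 -> (forall g, L g -> continuous g) ->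
  (forall g h, L g -> L h -> L (fun x => Num.min (g x) (h x))) ->
  (forall y, exists2 g, L g & g y < u y) ->
  exists2 g, L g & forall z, g z < u z.
Proof.
move=> /compact_near_coveringP cX uc [g0 Lg0] Lc Lmin Lu.
pose below g : set (X -> R) := [set h | L h /\ forall z, h z <= g z].
have FF : Filter (filter_from L below).
  apply: filter_from_filter; first by exists g0.
  move=> g h Lg Lh; exists (fun x => Num.min (g x) (h x)); first exact: Lmin.
  by move=> k [Lk kgh]; split; split=> // z; have := kgh z;
    rewrite le_min => /andP[].
have [y _|g Lg gu] := cX _ (filter_from L below) (fun g z => g z < u z) FF.
  have [g Lg gu] := Lu y.
  exists ([set z | g z < u z], below g); last first.
    by move=> [z h] /= [gz [_ hg]]; exact: le_lt_trans gz.
  split=> /=; last by exists g.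
  have : \forall z \near y, 0 < u z - g z.
    by apply: (cvgr_gt _ (cvgB (uc y) (Lc _ Lg y))); rewrite subr_gt0.
  by apply: filterS => z; rewrite subr_gt0.
by exists g => // z; apply: gu.
Qed.

Section StoneWeierstrass.
Context {X : topologicalType} {R : realType} (L : set (X -> R)).
Hypothesis X_compact : compact [set: X].
Hypothesis L_continuous : forall f, L f -> continuous f.
Hypothesis L0 : L (fun=> 0).
Hypothesis LD : forall f g, L f -> L g -> L (fun x => f x + g x).
Hypothesis LM : forall f g, L f -> L g -> L (fun x => f x * g x).
Hypothesis LZ : forall c f, L f -> L (fun x => c * f x).
Hypothesis L_closed : forall f,
  (forall e : R, 0 < e -> exists2 g, L g & forall x, `|f x - g x| <= e) -> L f.
Hypothesis L_separates : forall x y, x <> y -> exists2 f, L f & f x != f y.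
Hypothesis L_nonvanishing : forall x, exists2 f, L f & f x != 0.

Let LB f g : L f -> L g -> L (fun x => f x - g x).
Proof.
move=> Lf Lg; under eq_fun do rewrite -mulN1r.
by apply: LD => //; exact: LZ.
Qed.

(** An iteration for the square root of [s ^ 2] that is polynomial in [s] without
    constant term, so that it stays in algebras without unit. *)
Fixpoint abs_approx (n : nat) (s : R) : R :=
  if n is n'.+1 then
    abs_approx n' s + 2^-1 * (s * s - abs_approx n' s * abs_approx n' s)
  else 0.

Let abs_step (u s N : R) : 0 <= s -> s <= 1 -> 0 <= N -> 0 <= u -> u <= s ->
  (s - u) * (1 + N * (s / 2)) <= s ->
  [/\ 0 <= u + 2^-1 * (s * s - u * u), u + 2^-1 * (s * s - u * u) <= s &
    (s - (u + 2^-1 * (s * s - u * u))) * (1 + (N + 1) * (s / 2)) <= s].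
Proof.
move=> s0 s1 N0 u0 us du.
have E : s - (u + 2^-1 * (s * s - u * u)) = (s - u) * (1 - (s + u) / 2) by field.
split.
- have : 0 <= (s - u) * (s + u) by apply: mulr_ge0; lra.
  by rewrite -subr_sqr !expr2; lra.
- by rewrite -subr_ge0 E mulr_ge0//; lra.
- rewrite E; apply: le_trans du; rewrite -mulrA ler_wpM2l ?subr_ge0//.
  have {}N0 : 0 <= N * (s / 2) by rewrite mulr_ge0// divr_ge0.
  rewrite (mulrDl N) mul1r; move: (N * (s / 2)) N0 => {}N N0.
  have := mulr_ge0 N0 s0; have := mulr_ge0 N0 u0; have := mulr_ge0 s0 s0.
  have := mulr_ge0 s0 u0; lra.
Qed.

Let abs_rate (u s N e : R) : 0 < e -> 2 / e < N -> 0 <= u -> u <= s ->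
  (s - u) * (1 + N * (s / 2)) <= s -> s - u <= e.
Proof.
move=> e0 ne u0 us du; rewrite leNgt; apply/negP => eus.
have en : 2 < e * N by rewrite mulrC -ltr_pdivrMr.
have N0 : 0 < N by rewrite (lt_trans _ ne)// divr_gt0.
have s_gt0 : 0 < s by lra.
have : e * N * (s / 2) <= s.
  apply: le_trans du; rewrite mulrDr mulr1 -mulrA ler_wpDl//; first by lra.
  by rewrite ler_wpM2r ?ltW// mulr_gt0//; lra.
have : 2 * (s / 2) < e * N * (s / 2) by rewrite ltr_pM2r; lra.
lra.
Qed.

(* The error [d] satisfies [d (1 + n |s| / 2) <= |s|], hence [d <= 2 / n]
   uniformly in [s], although the convergence degenerates near [s = 0]. *)
Let abs_approxP n (s : R) : `|s| <= 1 ->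
  [/\ 0 <= abs_approx n s, abs_approx n s <= `|s| &
      (`|s| - abs_approx n s) * (1 + n%:R * (`|s| / 2)) <= `|s|].
Proof.
move=> s1; elim: n => [|n [u0 us du]].
  by rewrite /= subr0 mul0r addr0 mulr1; split.
rewrite -natr1 -[abs_approx n.+1 s]/(abs_approx n s +
  2^-1 * (s * s - abs_approx n s * abs_approx n s)).
have -> : s * s = `|s| * `|s| by rewrite -normrM ger0_norm// -expr2 sqr_ge0.
exact: abs_step.
Qed.

Let L_abs_approx n f : L f -> L (fun x => abs_approx n (f x)).
Proof.
move=> Lf; elim: n => [//|n Ln]/=.
by apply: LD => //; apply: LZ; apply: LB; exact: LM.
Qed.

Let L_norm_le1 f : L f -> (forall x, `|f x| <= 1) -> L (fun x => `|f x|).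
Proof.
move=> Lf f1; apply: L_closed => e e0.
have [n ne] : exists n : nat, 2 / e < n%:R.
  by exists (Num.bound (2 / e)); rewrite archi_boundP// divr_ge0// ltW.
exists (fun x => abs_approx n (f x)); first exact: L_abs_approx.
move=> x; have [u0 us du] := abs_approxP n (f1 x).
by rewrite ger0_norm ?subr_ge0//; exact: abs_rate du.
Qed.

Let L_norm f : L f -> L (fun x => `|f x|).
Proof.
move=> Lf; have [M M0 fM] := continuous_compact_bounded X_compact (L_continuous Lf).
have -> : (fun x => `|f x|) = fun x => M * `|M^-1 * f x|.
  by apply/funext => x; rewrite normrM gtr0_norm ?invr_gt0// mulVKf// gt_eqF.
apply/(LZ M (f := fun x => `|M^-1 * f x|))/L_norm_le1; first exact: LZ.
by move=> x; rewrite normrM gtr0_norm ?invr_gt0// ler_pdivrMl// mulr1.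
Qed.

Let L_min f g : L f -> L g -> L (fun x => Num.min (f x) (g x)).
Proof.
move=> Lf Lg.
under eq_fun do rewrite minr_absE mulrC.
by apply/LZ/LB; [exact: LD|exact/L_norm/LB].
Qed.

(* Without constants in [L], a function that separates [x] from [y] and does not
   vanish at [x] is corrected by its own square; if it vanishes at [x], by some
   other function that does not. *)
Let L_bump x y : x <> y -> exists2 f, L f & f x = 1 /\ f y = 0.
Proof.
move=> xy; have [g Lg gxy] := L_separates xy.
suff [f Lf [fx fy]] : exists2 f, L f & f x != 0 /\ f y = 0.
  exists (fun z => (f x)^-1 * f z); first exact: LZ.
  by rewrite mulVf// fy mulr0.
have [gx|gx] := eqVneq (g x) 0.
  have [h Lh hx] := L_nonvanishing x.
  exists (fun z => g y * h z - h y * g z); first by apply: LB; exact: LZ.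
  split; last by rewrite mulrC subrr.
  by rewrite gx mulr0 subr0 mulf_neq0// -gx eq_sym.
exists (fun z => g z * g z - g y * g z); first by apply: LB; [exact: LM|exact: LZ].
by rewrite subrr -mulrBl mulf_neq0// subr_eq0.
Qed.

Let L_interpolates x y a b : (x = y -> a = b) ->
  exists2 f, L f & f x = a /\ f y = b.
Proof.
move=> xyab; have [xy|xy] := pselect (x = y).
  have [f Lf fx] := L_nonvanishing x.
  exists (fun z => a / f x * f z); first exact: LZ.
  by rewrite -xy divfK// -xyab.
have [f Lf [fx fy]] := L_bump xy.
have [g Lg [gy gx]] := L_bump (not_eq_sym xy).
exists (fun z => a * f z + b * g z); first by apply: LD; exact: LZ.
by rewrite fx fy gx gy !mulr1 !mulr0 addr0 add0r.
Qed.

(** Members of [L] that interpolate [f] at two points are combined by minima into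
    functions that touch [f] at one point and stay below [f + e], and these by
    maxima into one within [e] of [f]; the maxima are the minima of the opposite
    functions. *)
Theorem stone_weierstrass f : continuous f -> L f.
Proof.
move=> fc; apply: L_closed => e e0.
have LN g : L g -> L (fun x => - g x).
  by move=> Lg; under eq_fun do rewrite -mulN1r; exact: LZ.
have upper x : exists2 g, L g & g x = f x /\ forall z, g z < f z + e.
  have [||g|g h|y|g [Lg gx] gf] := @min_closed_lt X R
    [set g | L g /\ g x = f x] (fun z => f z + e) X_compact.
  - by move=> z; apply: cvgD; [exact: fc|exact: cvg_cst].
  - by have [//|g Lg [gx _]] := @L_interpolates x x (f x) (f x); exists g.
  - by move=> [/L_continuous].
  - by move=> [Lg gx] [Lh hx]; split; [exact: L_min|rewrite gx hx minxx].
  - have [|g Lg [gx gy]] := @L_interpolates x y (f x) (f y); first by move=> ->.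
    by exists g; rewrite //= gy ltrDl.
  - by exists g.
have [||g|g h|y|g [Lg gf] fg] := @min_closed_lt X R
  [set g | L g /\ forall z, - g z < f z + e] (fun z => - f z + e) X_compact.
- by move=> z; apply: cvgD; [apply: cvgN; exact: fc|exact: cvg_cst].
- have [] := @min_closed_lt X R [set g | L g] (fun z => f z + e) X_compact.
  + by move=> z; apply: cvgD; [exact: fc|exact: cvg_cst].
  + by exists (fun=> 0).
  + by move=> g /L_continuous.
  + by move=> g h; exact: L_min.
  + by move=> y; have [g Lg [gx gf]] := upper y; exists g.
  + move=> g Lg gf; exists (fun z => - g z); split; first exact: LN.
    by move=> z; rewrite opprK.
- by case=> /L_continuous.
- move=> [Lg gf] [Lh hf]; split; first exact: L_min.
  by move=> z; have := gf z; have := hf z; rewrite minEle; case: ifP.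
- have [g Lg [gy gf]] := upper y.
  exists (fun z => - g z); last by rewrite gy ltrDl.
  by split=> [|z]; [exact: LN|rewrite opprK].
exists (fun z => - g z); first exact: LN.
move=> z; rewrite ler_norml; have := gf z; have := fg z; lra.
Qed.
End StoneWeierstrass.

(** * Real-valued norms over the complex numbers *)

Section RealNorm.
Context {R : realType}.
Implicit Types V : normedZmodType (Cplx R).

Definition toC (x : R) : Cplx R := real_complex R x.

HB.instance Definition _ := GRing.RMorphism.copy toC (real_complex R).

(** The norms at hand take their values among the nonnegative complex numbers;
    their real part is the norm in the usual sense. *)
Definition nrm V (x : V) : R := complex.Re (`|x| : Cplx R).

Lemma toC_le x y : (toC x <= toC y) = (x <= y). Proof. exact: lecR. Qed.

Lemma toC_lt x y : (toC x < toC y) = (x < y). Proof. exact: ltcR. Qed.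

Lemma toC_inj : injective toC. Proof. exact: complexI. Qed.

Lemma toC_nrm V (x : V) : toC (nrm x) = `|x|.
Proof. by apply: RRe_real; rewrite ger0_real. Qed.

Lemma toC_Re (c : Cplx R) : 0 <= c -> toC (complex.Re c) = c.
Proof. by move=> c0; apply: RRe_real; rewrite ger0_real. Qed.

Lemma Re_gt0 (c : Cplx R) : 0 < c -> 0 < complex.Re c.
Proof. by move=> c0; rewrite -toC_lt toC_Re ?ltW// rmorph0. Qed.

Lemma nrm_ge0 V (x : V) : 0 <= nrm x.
Proof. by rewrite -toC_le toC_nrm rmorph0 normr_ge0. Qed.

Lemma nrm_eq0 V (x : V) : nrm x = 0 -> x = 0.
Proof. by move=> x0; apply/normr0_eq0; rewrite -toC_nrm x0 rmorph0. Qed.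

Lemma nrm0 V : nrm (0 : V) = 0.
Proof. by apply: toC_inj; rewrite toC_nrm normr0 rmorph0. Qed.

Lemma nrmD V (x y : V) : nrm (x + y) <= nrm x + nrm y.
Proof. by rewrite -toC_le rmorphD/= !toC_nrm ler_normD. Qed.

Lemma nrmN V (x : V) : nrm (- x) = nrm x.
Proof. by apply: toC_inj; rewrite !toC_nrm normrN. Qed.

Lemma nrmB V (x y : V) : nrm (x - y) = nrm (y - x).
Proof. by rewrite -nrmN opprB. Qed.

Lemma nrm_dist V (x y z : V) : nrm (x - z) <= nrm (x - y) + nrm (y - z).
Proof. by rewrite -[x - z](subrKA y) nrmD. Qed.

Lemma nrm_toC (x : R) : nrm (toC x) = `|x|.
Proof. by rewrite /nrm normc_def /= expr0n addr0 sqrtr_sqr. Qed.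

Lemma nrmcM (c d : Cplx R) : nrm (c * d) = nrm c * nrm d.
Proof. by apply: toC_inj; rewrite rmorphM/= !toC_nrm normrM. Qed.

Lemma nrmc1 : nrm (1 : Cplx R) = 1.
Proof. by apply: toC_inj; rewrite toC_nrm normr1 rmorph1. Qed.

Lemma nrm_sqr (c : Cplx R) : nrm c ^+ 2 = complex.Re c ^+ 2 + complex.Im c ^+ 2.
Proof. by apply: toC_inj; rewrite rmorphXn/= toC_nrm -add_Re2_Im2. Qed.

Lemma nbhs_nrmP (V : pseudoMetricNormedZmodType (Cplx R)) (x : V) P :
  nbhs x P <-> exists2 e : R, 0 < e & forall y, nrm (x - y) < e -> P y.
Proof.
split.
  move=> /nbhs_normP[e /= e0 eP]; exists (complex.Re e).
    exact: Re_gt0.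
  move=> y; rewrite -toC_lt toC_nrm toC_Re ?ltW// => xy.
  exact: eP.
move=> [e e0 eP]; apply/nbhs_normP; exists (toC e) => /=.
  by rewrite -(rmorph0 toC) toC_lt.
by move=> y /= xy; apply: eP; rewrite -toC_lt toC_nrm.
Qed.

Lemma nrm_scale (V : normedModType (Cplx R)) (c : Cplx R) (x : V) :
  nrm (c *: x) = nrm c * nrm x.
Proof. by apply: toC_inj; rewrite rmorphM/= !toC_nrm normrZ. Qed.

Lemma cvg_nrmP T (F : set_system T) (FF : Filter F)
    (V : pseudoMetricNormedZmodType (Cplx R)) (f : T -> V) (x : V) :
  (f @ F --> x) <-> forall e : R, 0 < e -> \forall t \near F, nrm (x - f t) < e.
Proof.
split=> [fx e e0|fx P /nbhs_nrmP[e e0 eP]].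
  by apply: (fx [set y | nrm (x - y) < e]); apply/nbhs_nrmP; exists e.
by apply: filterS (fx e e0) => t; exact: eP.
Qed.

Lemma complete_cauchy (V : completeNormedModType (Cplx R)) (u : nat -> V) :
  (forall e : R, 0 < e -> exists N, forall n, (N <= n)%N -> nrm (u N - u n) <= e) ->
  exists l, forall e : R, 0 < e ->
    exists N, forall n, (N <= n)%N -> nrm (l - u n) <= e.
Proof.
move=> ucauchy; have : cvg (u @ \oo).
  apply/cauchy_cvgP/cauchyP => e e0.
  have e'0 := Re_gt0 e0; have [N uN] := ucauchy _ (divr_gt0 e'0 (ltr0Sn _ 1)).
  exists (u N); exists N => // n Nn; rewrite -ball_normE /ball_ /=.
  rewrite -toC_nrm -[e]toC_Re ?ltW// toC_lt.
  by rewrite (le_lt_trans (uN n Nn))// ltr_pdivrMr// mulr_natr mulr2n ltrDl.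
move=> /cvg_ex[l /= ul]; exists l => e e0.
move/cvg_nrmP : ul => /(_ e e0) [N _ Ne]; exists N => n Nn.
exact/ltW/Ne.
Qed.

Lemma continuous_pair_Cplx :
  continuous (fun p : R * R => (Complex p.1 p.2 : Cplx R)).
Proof.
move=> [x y]; apply/cvg_nrmP => e e0.
have e20 : 0 < e / 2 by rewrite divr_gt0.
exists (ball x (e / 2), ball y (e / 2)); first by split; exact: nbhsx_ballx.
move=> [x' y'] [/= xx' yy'].
have -> : (Complex x y : Cplx R) - Complex x' y' =
    toC (x - x') + toC (y - y') * 'i%C.
  by apply/eqP; rewrite eq_complex /=; apply/andP; split; apply/eqP; ring.
rewrite (le_lt_trans (nrmD _ _))// nrmcM.
have -> : nrm ('i%C : Cplx R) = 1.
  by rewrite /nrm normc_def /= expr0n expr1n add0r sqrtr1.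
rewrite mulr1 !nrm_toC (splitr e) ltrD//.
Qed.

Lemma Cplx_continuous_cst (T : topologicalType) (c : Cplx R) :
  continuous (fun _ : T => c).
Proof. by move=> x; exact: cvg_cst. Qed.

Lemma Cplx_continuousB (T : topologicalType) (f g : T -> Cplx R) :
  continuous f -> continuous g -> continuous (fun x => f x - g x).
Proof. by move=> fc gc x; apply: (@cvgB _ _ _ _ _ f g _ _ (fc x) (gc x)). Qed.

Lemma Cplx_continuousD (T : topologicalType) (f g : T -> Cplx R) :
  continuous f -> continuous g -> continuous (fun x => f x + g x).
Proof. by move=> fc gc x; apply: (@cvgD _ _ _ _ _ f g _ _ (fc x) (gc x)). Qed.

Lemma Cplx_continuousM (T : topologicalType) (f g : T -> Cplx R) :
  continuous f -> continuous g -> continuous (fun x => f x * g x).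
Proof. by move=> fc gc x; apply: (@cvgM _ _ _ _ f g _ _ (fc x) (gc x)). Qed.

Lemma abs_Re_le (c : Cplx R) : `|complex.Re c| <= nrm c.
Proof.
rewrite -(@ler_pXn2r _ 2) ?nnegrE ?nrm_ge0// real_normK ?num_real// nrm_sqr.
by rewrite lerDl sqr_ge0.
Qed.

Lemma abs_Im_le (c : Cplx R) : `|complex.Im c| <= nrm c.
Proof.
rewrite -(@ler_pXn2r _ 2) ?nnegrE ?nrm_ge0// real_normK ?num_real// nrm_sqr.
by rewrite lerDr sqr_ge0.
Qed.

Lemma Re_continuous (T : topologicalType) (f : T -> Cplx R) :
  continuous f -> continuous (fun x => complex.Re (f x)).
Proof.
move=> fc x; apply/cvgrPdist_lt => e e0.
have /cvg_nrmP/(_ e e0) := fc x; apply: filterS => y; apply: le_lt_trans.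
by apply: le_trans (abs_Re_le _); case: (f x) => a b; case: (f y).
Qed.

Lemma Im_continuous (T : topologicalType) (f : T -> Cplx R) :
  continuous f -> continuous (fun x => complex.Im (f x)).
Proof.
move=> fc x; apply/cvgrPdist_lt => e e0.
have /cvg_nrmP/(_ e e0) := fc x; apply: filterS => y; apply: le_lt_trans.
by apply: le_trans (abs_Im_le _); case: (f x) => a b; case: (f y).
Qed.

Lemma compact_disc (r : R) : compact [set c : Cplx R | nrm c <= r].
Proof.
apply: (@subclosed_compact _ _
  ((fun p : R * R => (Complex p.1 p.2 : Cplx R)) @` (`[-r, r] `*` `[-r, r]))).
- rewrite -openC openE => c /negP; rewrite -ltNge => rc.
  apply/nbhs_nrmP; exists (nrm c - r); first by rewrite subr_gt0.
  move=> d cd; apply/negP; rewrite -ltNge.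
  by have := nrm_dist c d 0; rewrite !subr0; lra.
- apply: continuous_compact; first exact/continuous_subspaceT/continuous_pair_Cplx.
  by apply: compact_setX; exact: segment_compact.
- move=> [x y] /= xyr; exists (x, y) => //.
  have r0 : 0 <= r := le_trans (nrm_ge0 _) xyr.
  have := nrm_sqr (Complex x y); move: (nrm_ge0 (Complex x y : Cplx R)) xyr.
  move: (nrm _) => n /= n0 nr nE.
  have x2 := sqr_ge0 x; have y2 := sqr_ge0 y.
  by split; rewrite /= in_itv/= -ler_norml -(@ler_pXn2r _ 2)// ?nnegrE//
    real_normK ?num_real//; nra.
Qed.
End RealNorm.

(** * Singular points of the resolvent *)

(** The seminorm [p] stands for the norm of a Banach algebra, and also for the
    quotient norm modulo a maximal ideal, pulled back to the algebra. *)
Section Resolvent.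
Context {R : realType} (B : comPzRingType) (i : {rmorphism Cplx R -> B}).
Variable p : B -> R.
Hypothesis p_ge0 : forall x, 0 <= p x.
Hypothesis pD : forall x y, p (x + y) <= p x + p y.
Hypothesis pM : forall x y, p (x * y) <= p x * p y.
Hypothesis p_scalar : forall c, p (i c) <= nrm c.

Let pN x : p (- x) <= p x.
Proof.
have -> : - x = i (-1) * x by rewrite rmorphN rmorph1 mulN1r.
by apply: le_trans (pM _ _) _; rewrite ler_piMl// (le_trans (p_scalar _))// nrmN nrmc1.
Qed.

Let pB x y : p (x - y) <= p x + p y.
Proof. by rewrite (le_trans (pD _ _))// lerD2l. Qed.

Let p1 : p 1 <= 1.
Proof. by rewrite -(rmorph1 i) (le_trans (p_scalar _))// nrmc1. Qed.

Let p_mod x y : p (x - y) = 0 -> p x <= p y.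
Proof. by move=> xy; rewrite -[x](subrK y) (le_trans (pD _ _))// xy add0r. Qed.

Let p_null x y z w : p x = 0 -> p y = 0 -> p (x * z + y * w) = 0.
Proof.
move=> x0 y0; apply/eqP; rewrite eq_le p_ge0 andbT.
by rewrite (le_trans (pD _ _))// (le_trans (lerD (pM _ _) (pM _ _)))//
  x0 y0 !mul0r addr0.
Qed.

Let p_pow x k : p (x ^+ (2 ^ k)%N) <= p x ^+ (2 ^ k)%N.
Proof.
elim: k => [|k IH]; first by rewrite !expr1.
rewrite expnSr !exprM !expr2 (le_trans (pM _ _))// ler_pM//.
Qed.

Definition inverse_mod (x y : B) := p (x * y - 1) = 0.

Let resolvent_bound b c c0 y y0 :
  inverse_mod (1 - i c * b) y -> inverse_mod (1 - i c0 * b) y0 ->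
  p (y - y0) <= nrm (c - c0) * p b * p y * p y0.
Proof.
move=> yP y0P; apply: (@le_trans _ _ (p (i (c - c0) * b * y * y0))).
  apply: p_mod; rewrite /inverse_mod in yP y0P.
  have -> : y - y0 - i (c - c0) * b * y * y0 =
      ((1 - i c * b) * y - 1) * y0 + ((1 - i c0 * b) * y0 - 1) * (- y).
    rewrite rmorphB; ring.
  exact: p_null.
do 3 (rewrite (le_trans (pM _ _))// ler_wpM2r//).
Qed.

Let radius_lt1 (c y : B) : inverse_mod (1 - c) y -> p (y - 1) <= 2 / 5 -> p c <= 2 / 3.
Proof.
move=> yP y1.
have : p c <= p ((y - 1) * (1 - c)).
  apply: p_mod; rewrite /inverse_mod in yP.
  have -> : c - (y - 1) * (1 - c) = ((1 - c) * y - 1) * (- 1) + ((1 - c) * y - 1) * 0.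
    ring.
  exact: p_null.
have := pM (y - 1) (1 - c).
have : p (y - 1) * p (1 - c) <= 2 / 5 * (1 + p c).
  by rewrite ler_pM// (le_trans (pB _ _))// lerD2r.
lra.
Qed.

Let near_one (c y : B) : inverse_mod (1 - c) y -> p c <= 1 / 4 -> p (y - 1) <= 1 / 3.
Proof.
move=> yP c4; rewrite /inverse_mod in yP.
have cy : p (y - 1) <= p (c * y).
  apply: p_mod.
  by have -> : y - 1 - c * y = (1 - c) * y - 1 by ring.
have := pM c y; have := pD (y - 1) 1; rewrite subrK.
have : p c * p y <= 1 / 4 * p y by rewrite ler_wpM2r.
have := p1; lra.
Qed.

Definition resolvent_close (e : R) (b b' : B) := forall c, nrm c = 1 ->
  exists y y', [/\ inverse_mod (1 - i c * b) y,
    inverse_mod (1 - i c * b') y' & p (y - y') <= e].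

(* If [s ^ 2 = c] then [(1 - c b ^ 2)^-1] is the mean of [(1 - s b)^-1] and
   [(1 + s b)^-1], and [s] is on the unit circle if [c] is. *)
Let resolvent_close_sqr e b b' :
  resolvent_close e b b' -> resolvent_close e (b * b) (b' * b').
Proof.
move=> cl c c1; set s : Cplx R := sqrtc c.
have sE : s * s = c by rewrite -expr2; exact: sqr_sqrtc.
have s1 : nrm s = 1.
  have : nrm s * nrm s = 1 by rewrite -nrmcM sE.
  by have := nrm_ge0 s; nra.
have [y [y' [yP yP' yy']]] := cl s s1.
have [|z [z' [zP zP' zz']]] := cl (- s); first by rewrite nrmN.
have ih : i (1 / 2) + i (1 / 2) = 1 by rewrite -rmorphD -splitr rmorph1.
have inv_half d u v : inverse_mod (1 - i s * d) u -> inverse_mod (1 - i (- s) * d) v ->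
    inverse_mod (1 - i c * (d * d)) (i (1 / 2) * (u + v)).
  rewrite /inverse_mod -sE rmorphM rmorphN => uP vP.
  have -> : (1 - i s * i s * (d * d)) * (i (1 / 2) * (u + v)) - 1 =
    ((1 - i s * d) * u - 1) * (i (1 / 2) * (1 + i s * d)) +
    ((1 - - i s * d) * v - 1) * (i (1 / 2) * (1 - i s * d)) +
    (i (1 / 2) + i (1 / 2) - 1) by ring.
  by rewrite ih subrr addr0; exact: p_null.
exists (i (1 / 2) * (y + z)), (i (1 / 2) * (y' + z')).
split; [exact: inv_half|exact: inv_half|].
rewrite -mulrBr opprD addrACA (le_trans (pM _ _))//.
have := p_scalar (1 / 2).
have -> : nrm (1 / 2 : Cplx R) = 1 / 2.
  have -> : 1 / 2 = toC (1 / 2 : R) by rewrite rmorphM fmorphV rmorph1 rmorph_nat.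
  by rewrite nrm_toC ger0_norm ?divr_ge0.
have := pD (y - y') (z - z'); have := p_ge0 (y - y' + (z - z')).
have := p_ge0 (i (1 / 2)); nra.
Qed.

Let resolvent_close_pow e b b' k : resolvent_close e b b' ->
  resolvent_close e (b ^+ (2 ^ k)%N) (b' ^+ (2 ^ k)%N).
Proof.
move=> cl; elim: k => [|k IH]; first by rewrite !expr1.
by rewrite expnSr !exprM !expr2; exact: resolvent_close_sqr.
Qed.

(* If [p (b ^ 2 ^ k) <= 1/4], the inverse of [1 - b ^ 2 ^ k] is within 1/3 of the
   unit; that of [1 - b' ^ 2 ^ k] is then within [1/3 + 1/15 = 2/5] of it, so that
   [p (b' ^ 2 ^ k) <= 2/3], and two more squarings suffice as [(2/3) ^ 4 <= 1/4]. *)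
Let small_pow_close b b' : resolvent_close (1 / 15) b b' ->
  (exists k, p (b ^+ (2 ^ k)%N) <= 1 / 4) -> exists k, p (b' ^+ (2 ^ k)%N) <= 1 / 4.
Proof.
move=> cl [k bk]; exists (k + 2)%N.
have [y [y' []]] := resolvent_close_pow k cl nrmc1.
rewrite rmorph1 !mul1r => yP yP' yy'; have := near_one yP bk => y1.
have /(radius_lt1 yP') b'23 : p (y' - 1) <= 2 / 5.
  have := pB (y - 1) (y - y'); have -> : y - 1 - (y - y') = y' - 1 by ring.
  lra.
rewrite expnD exprM (le_trans (p_pow _ 2))//.
have := p_ge0 (b' ^+ (2 ^ k)%N); move: (p _) b'23 => x x23 x0.
have : x ^+ 4 <= (2 / 3) ^+ 4 by rewrite ler_pXn2r// nnegrE divr_ge0.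
rewrite (_ : (2 ^ 2)%N = 4)//; lra.
Qed.

(* The resolvent identity shows that the inverses of [1 - c b] are at most twice
   as large as that of [1 - c0 b] for [c] near [c0]. *)
Let resolvent_bounded b :
  (forall c, nrm c <= 1 -> exists y, inverse_mod (1 - i c * b) y) ->
  exists2 M : R, 0 < M & forall c, nrm c <= 1 ->
    exists2 y, inverse_mod (1 - i c * b) y & p y <= M.
Proof.
move=> binv.
have /choice[y yP] c : exists y, nrm c <= 1 -> inverse_mod (1 - i c * b) y.
  have [/binv[y yP]|c1] := boolP (nrm c <= 1); first by exists y.
  by exists 0.
have /compact_near_coveringP/near_covering_withinP cD := @compact_disc R 1.
have [c0 /= c01|M [_ MP]] := cD R (pinfty_nbhs R) (fun M c => p (y c) <= M) _.
  pose m := p (y c0) + 1; pose q := p b + 1.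
  have m0 : 0 < m by rewrite ltr_wpDl.
  have q0 : 0 < q by rewrite ltr_wpDl.
  exists ([set c | nrm (c0 - c) < (2 * q * m)^-1], [set M | 2 * m <= M]).
    split; last by apply: nbhs_pinfty_ge; rewrite num_real.
    rewrite /=; apply: (proj2 (nbhs_nrmP c0 _)); exists (2 * q * m)^-1 => //.
    by rewrite invr_gt0 !mulr_gt0.
  move=> [c M] [/= cc0 mM] c1; apply: le_trans mM.
  have yb := resolvent_bound (yP _ c1) (yP _ c01).
  have : nrm (c - c0) * p b * p (y c) * p (y c0) <= p (y c) / 2.
    have -> : nrm (c - c0) * p b * p (y c) * p (y c0) =
      p (y c) * (nrm (c - c0) * (p b * p (y c0))) by ring.
    rewrite ler_wpM2l// nrmB; apply: (@le_trans _ _ ((2 * q * m)^-1 * (q * m))).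
      by rewrite ler_pM ?nrm_ge0 ?mulr_ge0 ?(ltW cc0)// ler_pM ?lerDl.
    by rewrite -(mulrA 2) invfM mulrVK ?unitfE ?gt_eqF ?mulr_gt0.
  have := pD (y c - y c0) (y c0); rewrite subrK /m; lra.
exists (`|M| + 1) => [|c c1]; first by rewrite ltr_wpDl.
exists (y c); first exact: yP.
by apply: MP => //; rewrite (le_lt_trans (ler_norm _))// ltrDl.
Qed.

(** A form of the spectral radius formula that contains the Gelfand-Mazur theorem.
    If all the [1 - c b] were invertible, their inverses would be bounded
    uniformly in the disc, and the resolvents of [t b] and [t' b] would be as
    close as one likes on the circle for close [t] and [t'] in [0, 1]. Having
    powers [(t b) ^ 2 ^ k] that become small would then propagate in finitely many
    steps from [t = 0] to [t = 1], and the [b ^ 2 ^ k] would tend to zero. *)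
Theorem resolvent_singular b (k0 : R) : 0 < k0 ->
  (forall k, k0 <= p (b ^+ (2 ^ k)%N)) ->
  exists2 c, nrm c <= 1 & forall y, ~ inverse_mod (1 - i c * b) y.
Proof.
move=> k0_gt0 bk0; apply: contrapT => nosing.
have [|M M0 MP] := @resolvent_bounded b.
  by move=> c c1; apply: contrapT => /forallNP nc; apply: nosing; exists c.
pose ray (t : R) := i (toC t) * b.
have ray_close (t t' : R) : 0 <= t <= 1 -> 0 <= t' <= 1 ->
    resolvent_close (`|t - t'| * (p b * M * M)) (ray t) (ray t').
  move=> /andP[t0 t1] /andP[t'0 t'1] c c1.
  have ct u : 0 <= u -> u <= 1 -> nrm (c * toC u) <= 1.
    by move=> u0 u1; rewrite nrmcM c1 mul1r nrm_toC ger0_norm.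
  have [y yP yM] := MP _ (ct t t0 t1); have [y' yP' yM'] := MP _ (ct t' t'0 t'1).
  exists y, y'; split.
  - by rewrite /ray mulrA -rmorphM.
  - by rewrite /ray mulrA -rmorphM.
  rewrite (le_trans (resolvent_bound yP yP'))// -mulrBr -rmorphB nrmcM c1 mul1r.
  by rewrite nrm_toC -!mulrA !ler_wpM2l// ler_pM.
have [N N0 NP] : exists2 N : nat, (0 < N)%N & 15 * (p b * M * M) <= N%:R.
  exists (Num.bound (15 * (p b * M * M))).+1 => //.
  apply: ltW; apply: lt_le_trans (archi_boundP _) _; last by rewrite ler_nat.
  by rewrite !mulr_ge0// ltW.
have N_gt0 : 0 < N%:R :> R by rewrite ltr0n.
pose frac (l : nat) : R := l%:R / N%:R.
have small j : (j <= N)%N -> exists k, p (ray (frac j) ^+ (2 ^ k)%N) <= 1 / 4.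
  elim: j => [_|j IH jN].
    exists 0%N; rewrite expr1 /frac mul0r /ray (rmorph0 toC) (rmorph0 i) mul0r.
    by rewrite -(rmorph0 i) (le_trans (p_scalar _))// nrm0 divr_ge0.
  have inI (l : nat) : (l <= N)%N -> 0 <= frac l <= 1.
    move=> lN; apply/andP; split; first by rewrite /frac divr_ge0.
    by rewrite /frac ler_pdivrMr// mul1r ler_nat.
  apply: small_pow_close (IH (ltnW jN)) => c c1.
  have [y [y' [yP yP' yy']]] := ray_close _ _ (inI j (ltnW jN)) (inI _ jN) c c1.
  exists y, y'; split=> //; apply: le_trans yy' _.
  rewrite /frac -mulrBl -natr1 opprD addNKr normrM normrN1 mul1r ger0_norm ?invr_ge0//.
  have : N%:R^-1 * (15 * (p b * M * M)) <= 1 by rewrite ler_pdivrMl// mulr1.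
  move: (p b * M * M) => X; rewrite mulrCA div1r; lra.
have [k] := small N (leqnn N).
rewrite /frac divff ?gt_eqF// /ray (rmorph1 toC) (rmorph1 i) mul1r.
move=> bk.
have [m mP] : exists m : nat, k0^-1 < m%:R.
  by exists (Num.bound k0^-1); rewrite archi_boundP// invr_ge0 ltW.
have := bk0 (k + m)%N; apply/negP; rewrite -ltNge expnD exprM.
apply: le_lt_trans (p_pow _ _) _; apply: (@le_lt_trans _ _ ((1 / 4) ^+ (2 ^ m)%N)).
  by rewrite ler_pXn2r ?expn_gt0 ?nnegrE ?divr_ge0.
rewrite div1r exprVn -natrX invf_plt ?posrE ?ltr0n ?expn_gt0//.
apply: lt_le_trans mP _; rewrite ler_nat.
by rewrite (leq_trans (ltnW (ltn_expl _ (isT : 1 < 2)%N)))// ltnW// ltn_expl.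
Qed.

End Resolvent.

(** * The ring structure and the Neumann series *)

(** A copy of the carrier, so as to equip it with a ring structure. *)
Definition cring (R : realType) (A : comCstarAlgType R) : Type := A.

HB.instance Definition _ (R : realType) (A : comCstarAlgType R) :=
  ComCStarAlgebra.on (cring A).

HB.instance Definition _ (R : realType) (A : comCstarAlgType R) :=
  GRing.Zmodule_isComPzRing.Build (cring A)
    (@cstar_mulA R A) (@cstar_mulC R A) (@cstar_mul1l R A) (@cstar_mulDl R A).

Section Algebra.
Context {R : realType} (A : comCstarAlgType R).
Local Notation B := (cring A).
Local Notation star := (@cstar_star R B).
Implicit Types x y z : B.

(** Scalars are turned into elements of the ring to compute in it. *)
Definition scal (c : Cplx R) : B := c *: (1 : B).

Lemma scalE c x : c *: x = scal c * x.
Proof.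
by rewrite /scal -[RHS]/(cstar_mul (c *: cstar_one) x) -cstar_scaleAl cstar_mul1l.
Qed.

Fact scal_is_additive : additive scal.
Proof. by move=> c d; rewrite /scal scalerBl. Qed.

Fact scal_is_multiplicative : multiplicative scal.
Proof. by split=> [c d|]; rewrite /scal ?scale1r// -scalerA scalE. Qed.

HB.instance Definition _ := GRing.isAdditive.Build (Cplx R) B scal scal_is_additive.
HB.instance Definition _ :=
  GRing.isMultiplicative.Build (Cplx R) B scal scal_is_multiplicative.

Lemma nrmM x y : nrm (x * y) <= nrm x * nrm y.
Proof. by rewrite -toC_le rmorphM/= !toC_nrm; exact: cstar_ler_normM. Qed.

Lemma nrm_starM x : nrm (star x * x) = nrm x ^+ 2.
Proof. by apply: toC_inj; rewrite rmorphXn/= !toC_nrm; exact: cstar_normE. Qed.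

Lemma starM x y : star (x * y) = star x * star y.
Proof. by rewrite mulrC; exact: cstar_starM. Qed.

Lemma star0 : star 0 = 0.
Proof. by apply: (addIr (star 0)); rewrite -cstar_starD !add0r. Qed.

Lemma starN x : star (- x) = - star x.
Proof. by apply: (addIr (star x)); rewrite -cstar_starD !addNr star0. Qed.

Lemma star1 : star (1 : B) = 1.
Proof.
have := starM (star (1 : B)) 1.
by rewrite mulr1 cstar_starK mul1r => <-.
Qed.

Lemma nrm_le_star x : nrm x <= nrm (star x).
Proof.
have [x0|x0] := eqVneq (nrm x) 0; first by rewrite x0 nrm_ge0.
have x_gt0 : 0 < nrm x by rewrite lt_neqAle nrm_ge0 eq_sym andbT.
by rewrite -(ler_pM2r x_gt0) -expr2 -nrm_starM nrmM.
Qed.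

Lemma nrm_star x : nrm (star x) = nrm x.
Proof.
by apply/eqP; rewrite eq_le nrm_le_star -{2}(cstar_starK x) nrm_le_star.
Qed.

Lemma nrm1_le : nrm (1 : B) <= 1.
Proof.
have := nrm_starM (1 : B); rewrite star1 mul1r => n1; have := nrm_ge0 (1 : B); nra.
Qed.

Lemma nrm_scal c : nrm (scal c) <= nrm c.
Proof. by rewrite nrm_scale ler_piMr ?nrm_ge0 ?nrm1_le. Qed.

Lemma nrmX x n : nrm (x ^+ n) <= nrm x ^+ n.
Proof.
elim: n => [|n IH]; first by rewrite !expr0 nrm1_le.
by rewrite !exprS (le_trans (nrmM _ _))// ler_wpM2l ?nrm_ge0.
Qed.

(** The partial sums of the geometric series converge. *)
Lemma neumann x : nrm x < 1 -> exists y, (1 - x) * y = 1.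
Proof.
move=> x1; pose s n := \sum_(i < n) x ^+ i.
have sE n : (1 - x) * s n = 1 - x ^+ n.
  elim: n => [|n IH]; first by rewrite /s big_ord0 mulr0 expr0 subrr.
  by rewrite /s big_ord_recr/= -/(s n) mulrDr IH exprS; ring.
have x0 : `|nrm x| < 1 by rewrite ger0_norm ?nrm_ge0.
have xn (e : R) : 0 < e -> exists N, nrm x ^+ N < e.
  move=> e0; have /cvgrPdist_lt/(_ e e0)[N _ NP] := cvg_expr x0.
  exists N; have := NP N (leqnn N).
  by rewrite /= sub0r normrN ger0_norm// exprn_ge0 ?nrm_ge0.
have tail N k : nrm (s N - s (N + k)%N) * (1 - nrm x) <= nrm x ^+ N * (1 - nrm x ^+ k).
  elim: k => [|k IH]; first by rewrite addn0 subrr nrm0 mul0r expr0 subrr mulr0.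
  rewrite addnS /s big_ord_recr/= -/(s _) opprD addrA.
  apply: (@le_trans _ _ ((nrm (s N - s (N + k)%N) + nrm x ^+ (N + k)) * (1 - nrm x))).
    rewrite ler_wpM2r ?subr_ge0 ?(ltW x1)// (le_trans (nrmD _ _))// nrmN lerD2l.
    exact: nrmX.
  rewrite mulrDl (le_trans (lerD IH (lexx _)))// exprD exprS.
  by rewrite le_eqVlt; apply/orP; left; apply/eqP; ring.
have [|y yP] := @complete_cauchy R B s.
  move=> e e0; have [|N Ne] := xn (e * (1 - nrm x)); first by rewrite mulr_gt0 ?subr_gt0.
  exists N => n /subnKC <-; rewrite -(@ler_pM2r _ (1 - nrm x)) ?subr_gt0//.
  rewrite (le_trans (tail _ _))// (le_trans _ (ltW Ne))// ler_piMr//.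
    by rewrite exprn_ge0 ?nrm_ge0.
  by rewrite lerBlDr lerDl exprn_ge0 ?nrm_ge0.
exists y; apply/eqP; rewrite -subr_eq0; apply/eqP/nrm_eq0.
apply/eqP; rewrite eq_le nrm_ge0 andbT; apply/ler_addgt0Pr => e e0.
rewrite add0r.
have M0 : 0 < nrm (1 - x) + 1 by rewrite ltr_wpDl ?nrm_ge0.
have [|N NP] := yP (e / 2 / (nrm (1 - x) + 1)); first by rewrite !divr_gt0.
have [|K KP] := xn (e / 2); first by rewrite divr_gt0.
pose n := maxn N K.
have -> : (1 - x) * y - 1 = (1 - x) * (y - s n) - x ^+ n by rewrite mulrBr sE; ring.
rewrite (le_trans (nrmD _ _))// nrmN (splitr e) lerD//.
  rewrite (le_trans (nrmM _ _))//.
  apply: (@le_trans _ _ ((nrm (1 - x) + 1) * (e / 2 / (nrm (1 - x) + 1)))).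
    by rewrite ler_pM ?nrm_ge0 ?lerDl// NP// leq_maxl.
  by rewrite mulrC divfK ?gt_eqF.
rewrite (le_trans (nrmX _ _))// (le_trans _ (ltW KP))//.
by rewrite ler_wiXn2l ?nrm_ge0 ?ltW// leq_maxr.
Qed.
End Algebra.

(** * Characters from maximal ideals *)

Section Characters.
Context {R : realType} (A : comCstarAlgType R).
Local Notation B := (cring A).
Local Notation star := (@cstar_star R B).
Local Notation scal := (@scal R A).
Implicit Types x y z : B.

Section MaximalIdeal.
Variable M : set B.
Hypothesis M0 : M 0.
Hypothesis MD : forall x y, M x -> M y -> M (x + y).
Hypothesis MM : forall x y, M x -> M (y * x).
Hypothesis M1 : ~ M 1.
Hypothesis M_max : forall x, ~ M x -> exists y, M (x * y - 1).

Let MN x : M x -> M (- x).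
Proof. by move=> Mx; rewrite -mulN1r; exact: MM. Qed.

Let dists x : set R := [set nrm (x - m) | m in M].

(** The quotient norm modulo [M], pulled back to the algebra. *)
Definition quotient_norm x : R := inf (dists x).
Local Notation p := quotient_norm.

Let has_inf_dists x : has_inf (dists x).
Proof.
split; first by exists (nrm (x - 0)), 0.
by exists 0 => _ [m _ <-]; exact: nrm_ge0.
Qed.

Let p_le x m : M m -> p x <= nrm (x - m).
Proof. by move=> Mm; apply: inf_lbound; [case: (has_inf_dists x)|exists m]. Qed.

Let le_p x (r : R) : (forall m, M m -> r <= nrm (x - m)) -> r <= p x.
Proof.
move=> rx; apply: lb_le_inf; first by case: (has_inf_dists x).
by move=> _ [m Mm <-]; exact: rx.
Qed.

Let p_adherent x (e : R) : 0 < e -> exists2 m, M m & nrm (x - m) < p x + e.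
Proof.
move=> e0; have [_ [m Mm <-] me] := inf_adherent e0 (has_inf_dists x).
by exists m.
Qed.

Let p_ge0 x : 0 <= p x.
Proof. by apply: le_p => m _; exact: nrm_ge0. Qed.

Let p_le_nrm x : p x <= nrm x.
Proof. by rewrite -{2}[x]subr0; exact: p_le. Qed.

Let pD x y : p (x + y) <= p x + p y.
Proof.
apply/ler_addgt0Pr => e e0.
have e20 : 0 < e / 2 by rewrite divr_gt0.
have [m Mm mx] := p_adherent x e20; have [n Mn ny] := p_adherent y e20.
apply: le_trans (p_le _ (MD Mm Mn)) _.
rewrite opprD addrACA (le_trans (nrmD _ _))//; lra.
Qed.

Let pM x y : p (x * y) <= p x * p y.
Proof.
apply/ler_addgt0Pr => e e0.
pose q := p x + p y + 1; have q0 : 0 < q by rewrite ltr_wpDl ?addr_ge0.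
pose d := Num.min 1 (e / q).
have d0 : 0 < d by rewrite lt_min ltr01 divr_gt0.
have [m Mm mx] := p_adherent x d0; have [n Mn ny] := p_adherent y d0.
have Mmn : M (y * m + x * n + (- n) * m) by apply: MD; [apply: MD|]; exact: MM.
apply: le_trans (p_le _ Mmn) _.
have -> : x * y - (y * m + x * n + - n * m) = (x - m) * (y - n) by ring.
rewrite (le_trans (nrmM _ _))//.
apply: (@le_trans _ _ ((p x + d) * (p y + d))).
  by rewrite ler_pM ?nrm_ge0 ?ltW.
have dq : d * q <= e by rewrite -ler_pdivlMr// ge_min lexx orbT.
have d1 : d * d <= d by rewrite ler_piMr ?(ltW d0)// ge_min lexx.
have -> : (p x + d) * (p y + d) = p x * p y + (d * (p x + p y) + d * d) by ring.
have : d * q = d * (p x + p y) + d by rewrite /q; ring.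
lra.
Qed.

Let p_scal c : p (scal c) <= nrm c.
Proof. exact: le_trans (p_le_nrm _) (nrm_scal _ _). Qed.

Let p_M x : M x -> p x = 0.
Proof.
by move=> Mx; apply/eqP; rewrite eq_le p_ge0 andbT (le_trans (p_le _ Mx))// subrr nrm0.
Qed.

Let p_cong x y : M (x - y) -> p x <= p y.
Proof. by move=> /p_M xy; rewrite -[x](subrK y) (le_trans (pD _ _))// xy add0r. Qed.

(* Elements at a distance less than one from the unit are invertible, so [M]
   contains none. *)
Let p1_ge1 : 1 <= p 1.
Proof.
apply: le_p => m Mm; rewrite leNgt; apply/negP => /neumann[y].
by rewrite subKr => my; apply: M1; rewrite -my mulrC; exact: MM.
Qed.

Let M_pow x y n : M (x * y - 1) -> M (x ^+ n * y ^+ n - 1).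
Proof.
move=> xy; elim: n => [|n IH]; first by rewrite !expr0 mul1r subrr.
have -> : x ^+ n.+1 * y ^+ n.+1 - 1 =
  x ^+ n * y ^+ n * (x * y - 1) + 1 * (x ^+ n * y ^+ n - 1) by rewrite !exprS; ring.
by apply: MD; exact: MM.
Qed.

(** Otherwise [a - c] would be invertible modulo [M] for every scalar [c]. In
    particular [a] would have an inverse [a'], and rescaling to
    [p a' <= 1] would bound the powers of [a] below, against
    [resolvent_singular]. *)
Lemma maximal_ideal_scalar (a : B) : exists c, M (a - scal c).
Proof.
apply: contrapT => /forallNP Na.
have [a' aa'] : exists a', M (a * a' - 1).
  by apply: M_max; have := Na 0; rewrite rmorph0 subr0.
pose s := p a'.
have s_gt0 : 0 < s.
  have pas : 1 <= p a * s.
    by apply: le_trans p1_ge1 (le_trans (p_cong _) (pM _ _)); rewrite -opprB; exact: MN.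
  rewrite lt_neqAle p_ge0 andbT; apply/eqP => s0.
  by move: pas; rewrite -s0 mulr0 ler10.
pose b := scal (toC s) * a; pose b' := scal (toC s^-1) * a'.
have scK c d : c * d = 1 -> scal c * scal d = 1 by move=> cd; rewrite -rmorphM cd rmorph1.
have scs : scal (toC s) * scal (toC s^-1) = 1.
  by apply: scK; rewrite -rmorphM divff ?gt_eqF// rmorph1.
have bb' : M (b * b' - 1).
  by rewrite /b /b' mulrACA scs mul1r.
have b'1 : p b' <= 1.
  rewrite (le_trans (pM _ _))//; apply: (@le_trans _ _ (s^-1 * s)).
    by rewrite ler_wpM2r ?p_ge0// (le_trans (p_scal _))// nrm_toC ger0_norm// invr_ge0 ltW.
  by rewrite mulVf ?gt_eqF.
have pX x n : p (x ^+ n.+1) <= p x ^+ n.+1.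
  elim: n => [|n IH]; first by rewrite !expr1.
  by rewrite exprS [leRHS]exprS (le_trans (pM _ _))// ler_wpM2l.
have b_ge1 k : 1 <= p (b ^+ (2 ^ k)%N).
  have := p_cong (_ : M (1 - b ^+ (2 ^ k)%N * b' ^+ (2 ^ k)%N)).
  rewrite -opprB => /(_ (MN (M_pow _ bb'))) p1.
  apply: le_trans p1_ge1 (le_trans p1 (le_trans (pM _ _) _)).
  rewrite ler_piMr// -[(2 ^ k)%N]prednK ?expn_gt0// (le_trans (pX _ _))//.
  by rewrite exprn_ile1.
have [c c1] := resolvent_singular p_ge0 pD pM p_scal ltr01 b_ge1.
have [->|c0] := eqVneq c 0.
  by move=> /(_ 1); case; rewrite /inverse_mod rmorph0 mul0r subr0 mulr1 subrr p_M.
pose d := (c * toC s)^-1.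
have s0 : toC s != 0 by rewrite fmorph_eq0 gt_eqF.
have [z zP] := M_max (Na d).
move=> /(_ (- scal d * z)); case; apply: p_M.
have -> : (1 - scal c * b) * (- scal d * z) - 1 = 
    scal (c * toC s * d) * (a - scal d) * z - 1 -
    scal d * z * (1 - scal (c * toC s * d)).
  by rewrite /b !rmorphM; ring.
by rewrite divff ?mulf_neq0// rmorph1 mul1r subrr mulr0 subr0.
Qed.

(** The scalar to which an element is congruent modulo [M] is unique, since [M]
    does not contain the unit, and depends on the element as a character does. *)
Lemma maximal_ideal_character :
  exists2 phi : A -> Cplx R, spectrum A phi & forall x, M x -> phi x = 0.
Proof.
have /choice[phi phiP] : forall a : B, exists c, M (a - scal c).
  exact: maximal_ideal_scalar.
have uniq a c : M (a - scal c) -> phi a = c.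
  move=> ac; apply: contrapT => /eqP; rewrite -subr_eq0 => pc.
  apply: M1; rewrite -(rmorph1 scal) -(mulVf pc) rmorphM; apply: MM.
  rewrite rmorphB.
  have -> : scal (phi a) - scal c = (a - scal c) + - (a - scal (phi a)) by ring.
  by apply: MD => //; exact/MN/phiP.
exists phi; last by move=> x Mx; apply: uniq; rewrite rmorph0 subr0.
split.
- move=> k u v; apply: uniq.
  have -> : (k *: u + v : B) - scal (k * phi u + phi v) =
      scal k * (u - scal (phi u)) + (v - scal (phi v)).
    by rewrite scalE rmorphD rmorphM; ring.
  by apply: MD; [apply: MM|]; exact: phiP.
- move=> x y; apply: uniq.
  have -> : (cstar_mul x y : B) - scal (phi x * phi y) =
      (y : B) * (x - scal (phi x)) + scal (phi x) * (y - scal (phi y)).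
    by rewrite -[cstar_mul x y]/((x : B) * (y : B)) rmorphM; ring.
  by apply: MD; apply: MM; exact: phiP.
- exists (1 : B); rewrite (uniq _ 1) ?oner_neq0// rmorph1 subrr //.
Qed.

End MaximalIdeal.

(** Zorn's lemma is applied to the ideals [I] such that [I + (x)] is proper; a
    maximal one contains [x] and is a maximal ideal. *)
Lemma noninvertible_character x : (forall y, x * y <> 1) ->
  exists2 phi : A -> Cplx R, spectrum A phi & phi x = 0.
Proof.
move=> xN.
pose P (I : set B) := [/\ forall u v, I u -> I v -> I (u + v),
  forall u v, I u -> I (v * u) & forall u v, I u -> u + x * v <> 1].
have [M [[MD MM Mx] Mmax]] : exists M, P M /\ forall I, M `<` I -> ~ P I.
  apply: Zorn_bigcup => F FP Ftot; split.
  - move=> u v [I FI Iu] [J FJ Jv]; have [IJ|JI] := Ftot _ _ FI FJ.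
      by exists J => //; have [JD _ _] := FP _ FJ; apply: JD => //; exact: IJ.
    by exists I => //; have [ID _ _] := FP _ FI; apply: ID => //; exact: JI.
  - by move=> u v [I FI Iu]; exists I => //; have [_ IM _] := FP _ FI; exact: IM.
  - by move=> u v [I FI Iu]; have [_ _ Ix] := FP _ FI; exact: Ix.
(* The empty set satisfies [P] as well, but it is not maximal. *)
have M0 : M 0.
  have [[u Mu]|Mempty] := pselect (M !=set0); first by rewrite -(mul0r u); exact: MM.
  exfalso; apply: (Mmax [set 0]).
    split=> [u Mu|/(_ 0 erefl) M0]; first by case: Mempty; exists u.
    by apply: Mempty; exists 0.
  split=> [u v -> ->|u v ->|u v ->]; first by rewrite addr0.
    by rewrite mulr0.
  by rewrite add0r; exact: xN.
have extend z : ~ M z -> exists u v w, M u /\ u + z * v + x * w = 1.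
  move=> Mz; apply: contrapT => nz.
  apply: (Mmax [set u + z * v | u in M & v in setT]).
    split=> [u Mu|sub]; first by exists u => //; exists 0 => //; rewrite mulr0 addr0.
    by apply: Mz; apply: sub; exists 0 => //; exists 1 => //; rewrite mulr1 add0r.
  split.
  - move=> _ _ [u Mu [v _ <-]] [u' Mu' [v' _ <-]].
    exists (u + u'); first exact: MD.
    by exists (v + v') => //; ring.
  - move=> _ r [u Mu [v _ <-]]; exists (r * u); first exact: MM.
    by exists (r * v) => //; ring.
  - move=> _ w [u Mu [v _ <-]] uvw; apply: nz.
    by exists u, v, w.
have Mxx : M x.
  apply: contrapT => /extend[u [v [w [Mu E]]]].
  by apply: (Mx u (v + w) Mu); rewrite -E; ring.
have [||phi sphi phiM] := @maximal_ideal_character M M0 MD MM.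
- by move=> M1; apply: (Mx 1 0 M1); rewrite mulr0 addr0.
- move=> z /extend[u [v [w [Mu E]]]]; exists v.
  have -> : z * v - 1 = - 1 * u + - w * x.
    by rewrite -[X in _ - X = _]E; ring.
  by apply: MD; exact: MM.
by exists phi => //; exact: phiM.
Qed.
End Characters.

(** * Pointwise convergence and elementary properties of characters *)

Section Pointwise.

Lemma ptws_cvgP (K : Type) (T : topologicalType) (F : set_system (K -> T))
    (FF : Filter F) (f : {ptws K -> T}) :
  F --> f <-> forall k, (fun g : K -> T => g k) @ F --> f k.
Proof.
split=> [/cvg_sup Ff k U fkU|Ff].
  by apply: (Ff k); exact: (@initial_continuous _ _ (fun g : K -> T => g k) f).
apply/cvg_sup => k U [V [[W Wo <-] Wfk] VU].
by apply: filterS VU _; apply: Ff; exact: open_nbhs_nbhs.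
Qed.

Lemma ptws_eval_continuous (K : Type) (T : topologicalType) (k : K) :
  continuous (fun f : {ptws K -> T} => f k).
Proof. by move=> f; have /ptws_cvgP := @cvg_id _ (nbhs f); exact. Qed.

Lemma ptws_continuous (X : topologicalType) (K : Type) (T : topologicalType)
    (f : X -> {ptws K -> T}) :
  (forall k, continuous (fun x => f x k)) -> continuous f.
Proof. by move=> fc x; apply/ptws_cvgP => k; exact: fc. Qed.

Lemma ptws_hausdorff (K : Type) (T : topologicalType) :
  hausdorff_space T -> hausdorff_space {ptws K -> T}.
Proof.
move=> hT f g fg; apply/funext => k; apply: hT => U V fU gV.
have [h [hU hV]] := fg _ _ (@ptws_eval_continuous K T k f _ fU)
  (@ptws_eval_continuous K T k g _ gV).
by exists (h k).
Qed.

Lemma set_val_continuous (T : topologicalType) (X : set T) :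
  continuous (set_val : X -> T).
Proof. exact: initial_continuous. Qed.

Lemma set_type_compact (T : topologicalType) (X : set T) :
  compact X -> compact [set: X].
Proof.
move=> cX F FF _.
have [|p [Xp Fp]] := cX (set_val @ F) (fmap_proper_filter _ FF).
  by apply: (@filterS _ F _ setT); [move=> x _; exact: set_valP|exact: filterT].
exists (SigSub (mem_set Xp)); split=> // U V FU [W [[Z Zo <-] Zp] ZV].
have [_ [[x Ux <-] Zx]] : set_val @` U `&` Z !=set0.
  apply: Fp; last exact: open_nbhs_nbhs.
  by apply: (@filterS _ F _ U _ _ FU) => x Ux; exists x.
by exists x; split=> //; exact: ZV.
Qed.

(** A continuous injection of a compact space is a closed map onto its image. *)
Lemma compact_embedding (X Y : topologicalType) (f : X -> Y) :
  compact [set: X] -> hausdorff_space Y -> continuous f -> injective f ->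
  embedding f.
Proof.
move=> cX hY fc finj.
pose h x : range f := SigSub (mem_set (imageT f x)).
have hval x : set_val (h x) = f x by [].
have hc : continuous h.
  move=> x U [_ [[Z Zo <-] Zfx] ZU]; apply: (@filterS _ _ _ (f @^-1` Z)).
    by move=> z Zfz; exact: ZU.
  by apply: fc; exact: open_nbhs_nbhs.
have /choice[g gP] (y : range f) : exists x, f x = set_val y.
  by have [x _ fx] := set_valP y; exists x.
exists h; split=> //; split=> //; exists g; split.
- apply/continuous_closedP => C clC.
  have -> : g @^-1` C = set_val @^-1` (f @` C).
    apply/seteqP; split=> [y Cy|y [x Cx fx]]; first by exists (g y).
    by rewrite /= (_ : g y = x)//; apply: finj; rewrite gP.
  have /continuous_closedP := @set_val_continuous Y (range f); apply.
  apply: compact_closed => //; apply: continuous_compact.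
    exact: continuous_subspaceT.
  exact: subclosed_compact clC cX _.
- by move=> x; apply: finj; rewrite gP.
- by move=> y; apply: val_inj; rewrite -[LHS]/(f (g y)) gP.
Qed.

End Pointwise.

Lemma closed_disc (R : realType) (r : R) : closed [set c : Cplx R | nrm c <= r].
Proof.
apply: compact_closed; last exact: compact_disc.
exact: norm_hausdorff.
Qed.

Section Spectrum.
Context {R : realType} (A : comCstarAlgType R).
Local Notation B := (cring A).
Local Notation star := (@cstar_star R B).
Local Notation scal := (@scal R A).
Implicit Types x y z : B.

Section Character.
Variable phi : A -> Cplx R.
Hypothesis phiP : spectrum A phi.

Lemma characterD x y : phi (x + y) = phi x + phi y.
Proof. by have [l _ _] := phiP; rewrite -[x]scale1r l mul1r scale1r. Qed.

Lemma character0 : phi 0 = 0.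
Proof. by apply: (addIr (phi 0)); rewrite -characterD !add0r. Qed.

Lemma characterZ c x : phi (c *: x) = c * phi x.
Proof. by have [l _ _] := phiP; rewrite -[c *: x]addr0 l character0 addr0. Qed.

Lemma characterM x y : phi (x * y) = phi x * phi y.
Proof. by have [_ m _] := phiP; exact: m. Qed.

Lemma characterB x y : phi (x - y) = phi x - phi y.
Proof. by rewrite characterD -scaleN1r characterZ mulN1r. Qed.

Lemma character1 : phi (1 : B) = 1.
Proof.
have [_ _ [x x0]] := phiP; apply: (mulIf x0).
by rewrite mul1r -[LHS](characterM (1 : B) x) mul1r.
Qed.

Lemma character_scal c : phi (scal c) = c.
Proof. by rewrite characterZ character1 mulr1. Qed.

(** If [phi x] exceeded [x] in norm, [1 - x / phi x] would be invertible, although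
    it is in the kernel of [phi]. *)
Lemma character_contraction x : nrm (phi x) <= nrm x.
Proof.
rewrite leNgt; apply/negP => xphi.
have phi_gt0 := le_lt_trans (nrm_ge0 x) xphi.
have phi0 : phi x != 0 by apply/eqP => p0; rewrite p0 nrm0 ltxx in phi_gt0.
have [|y] := @neumann R A (scal (phi x)^-1 * x).
  have := nrmM (scal (phi x)^-1) x; rewrite -scalE nrm_scale => _.
  have : nrm (phi x)^-1 * nrm (phi x) = 1 by rewrite -nrmcM mulVf// nrmc1.
  move=> E; rewrite -E ltr_pM2l//.
  rewrite lt_neqAle nrm_ge0 andbT; apply/eqP => n0.
  by move: E; rewrite -n0 mul0r => /eqP; rewrite eq_sym oner_eq0.
move=> /(congr1 phi); rewrite characterM characterB character1 characterM.
by rewrite character_scal mulVf// subrr mul0r => /esym/eqP; rewrite oner_eq0.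
Qed.

(** The square of the norm of [a + i t] is at most [|a| ^ 2 + t ^ 2]. If [phi a]
    had the imaginary part [be <> 0], the square of the modulus of
    [phi (a + i t)] would be at least [be ^ 2 + 2 be t + t ^ 2], which is larger
    for a suitable [t]. *)
Lemma character_real a : self_adjoint a -> complex.Im (phi a) = 0.
Proof.
move=> sa; apply/eqP; apply: contrapT => /negP b0.
set al := complex.Re (phi a); set be := complex.Im (phi a).
have shift t : al ^+ 2 + (be + t) ^+ 2 <= nrm a ^+ 2 + t ^+ 2.
  pose z : B := (a : B) + scal (Complex 0 t).
  have sz : star z = (a : B) - scal (Complex 0 t).
    rewrite /z cstar_starD [star a]sa /scal cstar_starZ star1.
    have -> : Num.conj (Complex 0 t : Cplx R) = - Complex 0 t.
      by apply/eqP; rewrite eq_complex /= oppr0 !eqxx.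
    by rewrite scaleNr.
  have := character_contraction z.
  have E : nrm (phi z) ^+ 2 = al ^+ 2 + (be + t) ^+ 2.
    rewrite nrm_sqr characterD character_scal /al /be.
    by case: (phi a) => u v /=; rewrite addr0.
  rewrite -(@ler_pXn2r _ 2) ?nnegrE ?nrm_ge0// E => /le_trans; apply.
  rewrite -nrm_starM sz.
  have -> : ((a : B) - scal (Complex 0 t)) * z = star a * (a : B) + scal (toC (t ^+ 2)).
    have sc : scal (Complex 0 t) * scal (Complex 0 t) = - scal (toC (t ^+ 2)).
      rewrite -rmorphM -rmorphN; congr (scal _).
      by apply/eqP; rewrite eq_complex /= expr2; apply/andP; split; apply/eqP; ring.
    rewrite [star a]sa -[scal (toC _)]opprK -sc /z; ring.
  rewrite (le_trans (nrmD _ _))// nrm_starM lerD2l (le_trans (nrm_scal _ _))//.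
  by rewrite nrm_toC ger0_norm// sqr_ge0.
have := shift ((nrm a ^+ 2 + 1) / (2 * be)).
have E : 2 * be * ((nrm a ^+ 2 + 1) / (2 * be)) = nrm a ^+ 2 + 1.
  by rewrite mulrC divfK// mulf_neq0.
move: (_ / _) E => t E; have := sqr_ge0 al; have := sqr_ge0 be.
rewrite sqrrD; lra.
Qed.

End Character.
End Spectrum.

(** * The Gelfand transform and the compactness of the spectrum *)

Section Gelfand.
Context {R : realType} (A : comCstarAlgType R).
Local Notation B := (cring A).
Local Notation star := (@cstar_star R B).
Local Notation scal := (@scal R A).
Implicit Types x y z : B.

Lemma nrm_pow_self_adjoint x k : star x = x -> nrm (x ^+ (2 ^ k)%N) = nrm x ^+ (2 ^ k)%N.
Proof.
move=> sx; have sxn n : star (x ^+ n) = x ^+ n.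
  by elim: n => [|n IH]; rewrite ?expr0 ?star1// exprS starM sx IH.
elim: k => [|k IH]; first by rewrite !expr1.
by rewrite expnSr !exprM !expr2 -IH -[X in X * _]sxn nrm_starM.
Qed.

(** The powers [b ^ 2 ^ k] of a self-adjoint [b] of norm one have norm one, so
    [resolvent_singular] makes some [1 - c b], with [c] in the unit disc,
    singular. A character that vanishes on it takes at [b] the value [c^-1], of
    modulus at least one. *)
Lemma self_adjoint_norm_le (a : A) (r : R) : self_adjoint a -> 0 <= r ->
  (forall phi, spectrum A phi -> nrm (phi a) <= r) -> nrm a <= r.
Proof.
move=> sa r0 ar; rewrite leNgt; apply/negP => ra.
have a0 : 0 < nrm a := le_lt_trans r0 ra.
pose s := (nrm a)^-1; have s0 : 0 < s by rewrite invr_gt0.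
pose b : B := toC s *: (a : B).
have b1 : nrm b = 1 by rewrite nrm_scale nrm_toC gtr0_norm// mulVf// gt_eqF.
have sb : star b = b.
  rewrite /b cstar_starZ [star a]sa; congr (_ *: _).
  by apply/eqP; rewrite eq_complex /= oppr0 !eqxx.
have powb k : 1 <= nrm (b ^+ (2 ^ k)%N) by rewrite nrm_pow_self_adjoint// b1 expr1n.
have [c c1 sing] := resolvent_singular (@nrm_ge0 R B) (@nrmD R B) (@nrmM R A)
  (@nrm_scal R A) ltr01 powb.
have [y xy|phi phiP phi0] := @noninvertible_character R A (1 - scal c * b).
  by apply: (sing y); rewrite /inverse_mod xy subrr nrm0.
have : c * (toC s * phi a) = 1.
  move: phi0; rewrite (characterB phiP) (characterM phiP) (character1 phiP).
  rewrite (character_scal phiP) /b (characterZ phiP) => /eqP.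
  by rewrite subr_eq0 => /eqP.
move=> /(congr1 (@nrm R (Cplx R))); rewrite !nrmcM nrmc1 nrm_toC gtr0_norm// => E.
have aphi : nrm a <= nrm (phi a).
  rewrite -(ler_pM2l s0) mulVf ?gt_eqF// -E ler_piMl//.
  by rewrite mulr_ge0 ?nrm_ge0// ltW.
by have := le_lt_trans (ar _ phiP) ra; rewrite ltNge aphi.
Qed.

Lemma self_adjoint_character_inj (a b : A) : self_adjoint a -> self_adjoint b ->
  (forall phi, spectrum A phi -> phi a = phi b) -> a = b.
Proof.
move=> sa sb ab; apply/eqP; rewrite -subr_eq0; apply/eqP/nrm_eq0/eqP.
rewrite eq_le nrm_ge0 andbT; apply: self_adjoint_norm_le => //.
  by rewrite /self_adjoint /= cstar_starD [X in _ + X](starN (b : B)) sa sb.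
by move=> phi phiP; rewrite (characterB phiP) ab// subrr nrm0.
Qed.

Definition gelfand (a : A) (phi : spectrum A) : Cplx R :=
  (set_val phi : A -> Cplx R) a.

Lemma gelfandD (a b : A) phi : gelfand (a + b) phi = gelfand a phi + gelfand b phi.
Proof. exact: (characterD (set_valP phi)). Qed.

Lemma gelfandB (a b : A) phi : gelfand (a - b) phi = gelfand a phi - gelfand b phi.
Proof. exact: (characterB (set_valP phi)). Qed.

Lemma gelfandZ c (a : A) phi : gelfand (c *: a) phi = c * gelfand a phi.
Proof. exact: (characterZ (set_valP phi)). Qed.

Lemma gelfandM x y phi : gelfand (x * y : B) phi = gelfand x phi * gelfand y phi.
Proof. exact: (characterM (set_valP phi)). Qed.

Lemma gelfand0 phi : gelfand (0 : A) phi = 0.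
Proof. exact: (character0 (set_valP phi)). Qed.

Lemma gelfand1 phi : gelfand (1 : B) phi = 1.
Proof. exact: (character1 (set_valP phi)). Qed.

Lemma gelfand_contraction (a : A) phi : nrm (gelfand a phi) <= nrm a.
Proof. exact: (character_contraction (set_valP phi)). Qed.

Lemma gelfand_continuous a : continuous (gelfand a).
Proof.
move=> phi; apply: (@continuous_comp _ _ _ set_val (fun f : {ptws A -> Cplx R} => f a)).
  exact: set_val_continuous.
exact: ptws_eval_continuous.
Qed.

Lemma spectrum_ext (phi psi : spectrum A) :
  (forall a, gelfand a phi = gelfand a psi) -> phi = psi.
Proof. by move=> pp; apply/val_inj/funext. Qed.

(** The unital, linear and multiplicative functions form a closed subset of the
    product of the discs of radius [nrm a], which is compact by Tychonoff's
    theorem. *)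
Lemma spectrum_compact : compact [set: spectrum A].
Proof.
apply: set_type_compact.
have zero_closed (f : {ptws A -> Cplx R} -> Cplx R) :
    continuous f -> closed [set phi | f phi = 0].
  move=> fc; have -> : [set phi | f phi = 0] = f @^-1` [set c | nrm c <= 0].
    apply/seteqP; split=> phi /= => [->|n0]; first by rewrite nrm0.
    by apply/nrm_eq0/eqP; rewrite eq_le n0 nrm_ge0.
  by move/continuous_closedP : fc; apply; exact: closed_disc.
have -> : spectrum A = 
    [set phi | forall p : Cplx R * A * A,
       phi (p.1.1 *: p.1.2 + p.2) - (p.1.1 * phi p.1.2 + phi p.2) = 0] `&`
    [set phi | forall p : A * A, phi (cstar_mul p.1 p.2) - phi p.1 * phi p.2 = 0] `&`
    [set phi | phi (cstar_one : A) - 1 = 0] `&`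
    [set phi | forall a : A, nrm (phi a) <= nrm a].
  apply/seteqP; split=> phi.
    move=> phiP; split; [split; [split|]|].
    - by move=> [[k u] v]; have [-> _ _] := phiP; rewrite subrr.
    - by move=> [u v]; have [_ -> _] := phiP; rewrite subrr.
    - by rewrite /= -[phi _]/(phi (1 : B)) (character1 phiP) subrr.
    - by move=> a; exact: character_contraction phiP a.
  move=> [[[phiL phiM] /= /eqP phi1] _]; split.
  - by move=> k u v; apply/eqP; rewrite -subr_eq0; apply/eqP; exact: (phiL (k, u, v)).
  - by move=> u v; apply/eqP; rewrite -subr_eq0; apply/eqP; exact: (phiM (u, v)).
  - by exists cstar_one; move: phi1; rewrite subr_eq0 => /eqP ->; exact: oner_neq0.
rewrite setIC; apply: compact_closedI.
  apply: (@tychonoff A (fun=> Cplx R) (fun a => [set c | nrm c <= nrm a])) => a.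
  exact: compact_disc.
have evc (a : A) : continuous (fun phi : {ptws A -> Cplx R} => phi a).
  exact: ptws_eval_continuous.
have cstc (c : Cplx R) := @Cplx_continuous_cst R {ptws A -> Cplx R} c.
apply: closedI; [apply: closedI|].
- rewrite (_ : mkset _ = \bigcap_p [set phi : {ptws A -> Cplx R} |
    phi (p.1.1 *: p.1.2 + p.2) - (p.1.1 * phi p.1.2 + phi p.2) = 0]); last first.
    by apply/seteqP; split=> phi /= H p; [move=> _; exact: H|exact: H].
  apply: closed_bigI => p _; apply: zero_closed.
  exact: (Cplx_continuousB (evc _)
    (Cplx_continuousD (Cplx_continuousM (cstc p.1.1) (evc p.1.2)) (evc p.2))).
- rewrite (_ : mkset _ = \bigcap_p [set phi : {ptws A -> Cplx R} |
    phi (cstar_mul p.1 p.2) - phi p.1 * phi p.2 = 0]); last first.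
    by apply/seteqP; split=> phi /= H p; [move=> _; exact: H|exact: H].
  apply: closed_bigI => p _; apply: zero_closed.
  exact: (Cplx_continuousB (evc _) (Cplx_continuousM (evc p.1) (evc p.2))).
- apply: zero_closed.
  exact: (Cplx_continuousB (evc _) (cstc 1)).
Qed.

End Gelfand.

(** * Closed subalgebras generated by self-adjoint elements *)

Section Generated.
Context {R : realType} (A : comCstarAlgType R).
Local Notation B := (cring A).
Local Notation star := (@cstar_star R B).
Local Notation scal := (@scal R A).
Implicit Types (x y z : B) (S : set A).

Lemma productsE S x : products S x <->
  exists n (s : 'I_n.+1 -> B), (forall i, S (s i)) /\ x = \prod_(i < n.+1) s i.
Proof. by []. Qed.

Lemma products_gen S : S `<=` products S.
Proof.
move=> x Sx; apply/productsE; exists 0%N, (fun=> x); split=> //.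
by rewrite big_ord1.
Qed.

Lemma productsM S x y : products S x -> products S y -> products S (x * y : B).
Proof.
move=> /productsE[n [s [Ss ->]]] /productsE[m [t [St ->]]]; apply/productsE.
exists (n + m.+1)%N, (fun i : 'I_(n.+1 + m.+1) =>
  match fintype.split i with inl j => s j | inr k => t k end).
split=> [i|]; first by case: fintype.split.
rewrite -[(n + m.+1).+1]/(n.+1 + m.+1)%N big_split_ord /=.
by congr (_ * _); apply: eq_bigr => i _;
  [rewrite -[lshift _ _]/(unsplit (inl i))|rewrite -[rshift _ _]/(unsplit (inr i))];
  rewrite unsplitK.
Qed.

Lemma linear_span_gen (X : set A) : X `<=` linear_span X.
Proof.
move=> x Xx; exists 1%N, (fun=> 1), (fun=> x); split=> //.
by rewrite big_ord1 scale1r.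
Qed.

Lemma linear_span0 (X : set A) : linear_span X 0.
Proof.
exists 0%N, (fun=> 0), (fun=> 0); split; first by case.
by rewrite big_ord0.
Qed.

Lemma linear_spanD (X : set A) a b :
  linear_span X a -> linear_span X b -> linear_span X (a + b).
Proof.
move=> [n [c [v [Xv ->]]]] [m [d [w [Xw ->]]]].
exists (n + m)%N, (fun i => match fintype.split i with inl j => c j | inr k => d k end),
  (fun i => match fintype.split i with inl j => v j | inr k => w k end).
split=> [i|]; first by case: fintype.split.
rewrite big_split_ord /=.
by congr (_ + _); apply: eq_bigr => i _;
  [rewrite -[lshift _ _]/(unsplit (inl i))|rewrite -[rshift _ _]/(unsplit (inr i))];
  rewrite unsplitK.
Qed.

Lemma linear_spanZ (X : set A) k a : linear_span X a -> linear_span X (k *: a).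
Proof.
move=> [n [c [v [Xv ->]]]]; exists n, (fun i => k * c i), v; split=> //.
by rewrite scaler_sumr; apply: eq_bigr => i _; rewrite scalerA.
Qed.

Lemma linear_span_ind (X Y : set A) : Y 0 -> (forall a b, Y a -> Y b -> Y (a + b)) ->
  (forall k a, Y a -> Y (k *: a)) -> X `<=` Y -> linear_span X `<=` Y.
Proof.
move=> Y0 YD YZ XY _ [n [c [v [Xv ->]]]].
by apply: big_ind => // i _; apply/YZ/XY.
Qed.

(** By bilinearity, one factor at a time. *)
Lemma linear_spanM S x y : linear_span (products S) x -> linear_span (products S) y ->
  linear_span (products S) (x * y : B).
Proof.
move=> Sx; move: y.
apply: (@linear_span_ind _ (fun y : B => linear_span (products S) (x * y : B))).
- by rewrite mulr0; exact: linear_span0.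
- by move=> a b Sa Sb; rewrite (mulrDr x a b); exact: linear_spanD.
- move=> k a Sa; have -> : x * (k *: (a : B)) = k *: (x * (a : B)).
    by rewrite !scalE; ring.
  exact: linear_spanZ.
move=> y Sy; move: x Sx.
apply: (@linear_span_ind _ (fun x : B => linear_span (products S) (x * y : B))).
- by rewrite mul0r; exact: linear_span0.
- by move=> a b Sa Sb; rewrite (mulrDl (a : B) b y); exact: linear_spanD.
- move=> k a Sa; have -> : k *: (a : B) * y = k *: ((a : B) * y).
    by rewrite !scalE; ring.
  exact: linear_spanZ.
- by move=> x Sx; apply/linear_span_gen/productsM.
Qed.

Definition closed_span S : set A := closure (linear_span (products S)).

Lemma closureP (X : set A) a :
  closure X a <-> forall e : R, 0 < e -> exists2 b, X b & nrm (a - b) <= e.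
Proof.
split=> [Xa e e0|Xa U /nbhs_nrmP[e e0 eU]].
  have [|b [Xb be]] := Xa [set b | nrm (a - b) < e].
    by apply/nbhs_nrmP; exists e.
  by exists b => //; exact: ltW.
have [|b Xb be] := Xa (e / 2); first by rewrite divr_gt0.
exists b; split=> //; apply: eU; apply: le_lt_trans be _.
by rewrite ltr_pdivrMr// mulr_natr mulr2n ltrDl.
Qed.

Lemma closed_span_closed S a :
  (forall e : R, 0 < e -> exists2 b, closed_span S b & nrm (a - b) <= e) ->
  closed_span S a.
Proof.
move=> Sa; rewrite /closed_span.
have /closure_id -> := @closed_closure _ (linear_span (products S)).
exact/closureP.
Qed.

Lemma closed_span_gen S : S `<=` closed_span S.
Proof. by move=> a Sa; apply/subset_closure/linear_span_gen/products_gen. Qed.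

Lemma closed_span0 S : closed_span S 0.
Proof. exact/subset_closure/linear_span0. Qed.

Lemma closed_spanD S a b : closed_span S a -> closed_span S b -> closed_span S (a + b).
Proof.
move=> /closureP Sa /closureP Sb; apply/closureP => e e0.
have e20 : 0 < e / 2 by rewrite divr_gt0.
have [a' Sa' aa'] := Sa _ e20; have [b' Sb' bb'] := Sb _ e20.
exists (a' + b'); first exact: linear_spanD.
by rewrite opprD addrACA (splitr e) (le_trans (nrmD _ _))// lerD.
Qed.

Lemma closed_spanM S x y :
  closed_span S x -> closed_span S y -> closed_span S (x * y : B).
Proof.
move=> /closureP Sx /closureP Sy; apply/closureP => e e0.
pose q := nrm x + nrm y + 1; have q0 : 0 < q by rewrite ltr_wpDl ?addr_ge0 ?nrm_ge0.
pose d := Num.min 1 (e / q).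
have d0 : 0 < d by rewrite lt_min ltr01 divr_gt0.
have [u Su xu] := Sx _ d0; have [v Sv yv] := Sy _ d0.
exists ((u : B) * v); first exact: linear_spanM.
have -> : x * y - (u : B) * v = (x - (u : B)) * y + (u : B) * (y - v) by ring.
have d1 : d <= 1 by rewrite ge_min lexx.
have dq : d * q <= e by rewrite -ler_pdivlMr// ge_min lexx orbT.
have u1 : nrm u <= nrm x + 1.
  by rewrite -[u](subKr (x : A)) (le_trans (nrmD _ _))// nrmN lerD2l (le_trans xu).
rewrite (le_trans (nrmD _ _))//; apply: (@le_trans _ _ (d * nrm y + (nrm x + 1) * d)).
  rewrite lerD// (le_trans (nrmM _ _))//; first by rewrite ler_wpM2r ?nrm_ge0.
  by rewrite ler_pM ?nrm_ge0.
have : d * q = d * nrm y + (nrm x + 1) * d by rewrite /q; ring.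
lra.
Qed.

Lemma closed_spanZ S k a : closed_span S a -> closed_span S (k *: a).
Proof.
move=> /closureP Sa; apply/closureP => e e0.
have k1 : 0 < nrm k + 1 by rewrite ltr_wpDl ?nrm_ge0.
have [|a' Sa' aa'] := Sa (e / (nrm k + 1)); first by rewrite divr_gt0.
exists (k *: a'); first exact: linear_spanZ.
rewrite -scalerBr nrm_scale; apply: (@le_trans _ _ ((nrm k + 1) * (e / (nrm k + 1)))).
  by rewrite ler_pM ?nrm_ge0// lerDl.
by rewrite mulrC divfK ?gt_eqF.
Qed.

Lemma self_adjointD (a b : A) :
  self_adjoint a -> self_adjoint b -> self_adjoint (a + b).
Proof. by move=> sa sb; rewrite /self_adjoint /= cstar_starD sa sb. Qed.

Lemma self_adjointM x y :
  self_adjoint x -> self_adjoint y -> self_adjoint (x * y : B).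
Proof.
move=> sx sy; apply: etrans (starM x y) _.
by rewrite [star x]sx [star y]sy.
Qed.

Lemma conj_toC (t : R) : Num.conj (toC t) = toC t.
Proof. by apply/eqP; rewrite eq_complex /= oppr0 !eqxx. Qed.

Lemma self_adjointZ (t : R) (a : A) : self_adjoint a -> self_adjoint (toC t *: a).
Proof. by move=> sa; rewrite /self_adjoint /= cstar_starZ conj_toC sa. Qed.

Lemma self_adjointB (a b : A) :
  self_adjoint a -> self_adjoint b -> self_adjoint (a - b).
Proof.
move=> sa sb; rewrite -[- b]scaleN1r -(rmorph1 toC) -rmorphN.
exact/self_adjointD/self_adjointZ.
Qed.

Lemma self_adjoint_closed (a : A) :
  (forall e : R, 0 < e -> exists2 b, self_adjoint b & nrm (a - b) <= e) ->
  self_adjoint a.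
Proof.
move=> Sa; apply/eqP; rewrite -subr_eq0; apply/eqP/nrm_eq0/eqP.
rewrite eq_le nrm_ge0 andbT; apply/ler_addgt0Pr => e e0; rewrite add0r.
have [|b sb ab] := Sa (e / 2); first by rewrite divr_gt0.
rewrite (le_trans (nrm_dist _ b _))// (splitr e) lerD// nrmB//.
by rewrite -[X in nrm (X - _)]sb -starN -cstar_starD (nrm_star (b - a : B)) nrmB.
Qed.

Lemma self_adjoint_span (a : A) :
  exists b c, [/\ self_adjoint b, self_adjoint c & a = b + ('i%C : Cplx R) *: c].
Proof.
pose h : Cplx R := toC (2^-1); pose i : Cplx R := 'i%C.
have hh : h + h = 1 by rewrite -rmorphD -(rmorph1 toC) [in RHS](splitr 1) !mul1r.
have conjih : Num.conj (- i * h) = i * h.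
  by apply/eqP; rewrite eq_complex /=; apply/andP; split; apply/eqP; ring.
have ii : i * - i = 1 by rewrite mulrN -expr2 sqr_i opprK.
exists (h *: (a + cstar_star a)), ((- i * h) *: (a - cstar_star a)); split.
- by rewrite /self_adjoint /= cstar_starZ conj_toC cstar_starD cstar_starK addrC.
- rewrite /self_adjoint /= cstar_starZ conjih.
  rewrite cstar_starD (starN (star (a : B))) cstar_starK.
  by rewrite -opprB scalerN mulNr scaleNr.
- rewrite scalerA mulrA ii mul1r -scalerDr addrACA subrr addr0.
  by rewrite scalerDr -scalerDl hh scale1r.
Qed.

Section Density.
Variable S : set A.
Hypothesis S_self_adjoint : S `<=` self_adjoint.
Hypothesis S_separates : forall phi psi : spectrum A, phi <> psi ->
  exists2 s, S s & gelfand s phi <> gelfand s psi.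
Hypothesis S_nonvanishing : forall phi : spectrum A,
  exists2 s, S s & gelfand s phi <> 0.

Let L : set (spectrum A -> R) := [set f | exists a, [/\ closed_span S a,
  self_adjoint a & forall phi, gelfand a phi = toC (f phi)]].

Lemma gelfand_real (a : A) (phi : spectrum A) : self_adjoint a ->
  gelfand a phi = toC (complex.Re (gelfand a phi)).
Proof.
move=> sa; apply/eqP; rewrite eq_complex eqxx; apply/eqP.
exact: character_real (set_valP phi) a sa.
Qed.

(* Uniform convergence in [C(D)] is convergence in [A], by
   [self_adjoint_norm_le]; and [A] is complete. *)
Let L_limit f : (forall e : R, 0 < e ->
  exists2 g, L g & forall phi, `|f phi - g phi| <= e) -> L f.
Proof.
move=> fL.
have /choice[a aP] n : exists a, [/\ closed_span S a, self_adjoint a &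
    forall phi, nrm (toC (f phi) - gelfand a phi) <= n.+1%:R^-1].
  have [|g [a [Sa sa ag]] fg] := fL n.+1%:R^-1; first by rewrite invr_gt0.
  by exists a; split=> // phi; rewrite ag -rmorphB nrm_toC.
have small (e : R) : 0 < e -> exists N, forall n, (N <= n)%N -> n.+1%:R^-1 <= e.
  move=> e0; exists (Num.bound e^-1) => n Nn.
  rewrite -[leRHS]invrK lef_pV2 ?posrE ?invr_gt0//.
  apply: ltW; apply: lt_le_trans (archi_boundP _) _; first by rewrite invr_ge0 ltW.
  by rewrite ler_nat ltnW.
have [|l lP] := @complete_cauchy R A a.
  move=> e e0; have [|N NP] := small (e / 2); first by rewrite divr_gt0.
  exists N => n Nn; have [_ saN fN] := aP N; have [_ san fn] := aP n.
  apply: self_adjoint_norm_le; [exact: self_adjointB|exact: ltW|].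
  move=> phi phiP; pose psi : spectrum A := SigSub (mem_set phiP).
  rewrite (characterB phiP) (le_trans (nrm_dist _ (toC (f psi)) _))// (splitr e).
  rewrite lerD//; last exact: le_trans (fn psi) (NP _ Nn).
  by rewrite nrmB (le_trans (fN psi))// NP.
exists l; split.
- apply: closed_span_closed => e e0; have [N NP] := lP e e0.
  by exists (a N); [have [] := aP N|exact: NP].
- apply: self_adjoint_closed => e e0; have [N NP] := lP e e0.
  by exists (a N); [have [] := aP N|exact: NP].
- move=> phi; apply/eqP; rewrite -subr_eq0; apply/eqP/nrm_eq0/eqP.
  rewrite eq_le nrm_ge0 andbT; apply/ler_addgt0Pr => e e0; rewrite add0r.
  have e20 : 0 < e / 2 by rewrite divr_gt0.
  have [N NP] := lP _ e20; have [M MP] := small _ e20.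
  pose n := maxn N M; have [_ _ fn] := aP n.
  rewrite (le_trans (nrm_dist _ (gelfand (a n) phi) _))// (splitr e) lerD//.
    by rewrite -gelfandB (le_trans (gelfand_contraction _ _))// NP// leq_maxl.
  by rewrite nrmB (le_trans (fn phi))// MP// leq_maxr.
Qed.

Lemma closed_span_surjective (f : spectrum A -> R) : continuous f ->
  exists a, [/\ closed_span S a, self_adjoint a &
    forall phi, gelfand a phi = toC (f phi)].
Proof.
have Lgen s : S s -> L (fun phi => complex.Re (gelfand s phi)).
  move=> Ss; exists s; split; [exact: closed_span_gen|exact: S_self_adjoint|].
  by move=> phi; exact/gelfand_real/S_self_adjoint.
apply: (@stone_weierstrass _ R L).
- exact: spectrum_compact.
- move=> g [a [Sa sa ag]].
  have -> : g = fun phi => complex.Re (gelfand a phi).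
    by apply/funext => phi; rewrite ag.
  exact/Re_continuous/gelfand_continuous.
- exists 0; split; first exact: closed_span0.
    by rewrite /self_adjoint /= (star0 A).
  by move=> phi; rewrite rmorph0 gelfand0.
- move=> g h [a [Sa sa ag]] [b [Sb sb bh]]; exists (a + b); split.
  + exact: closed_spanD.
  + exact: self_adjointD.
  + by move=> phi; rewrite rmorphD/= -ag -bh gelfandD.
- move=> g h [a [Sa sa ag]] [b [Sb sb bh]]; exists ((a : B) * b); split.
  + exact: closed_spanM.
  + exact: self_adjointM.
  + by move=> phi; rewrite rmorphM/= -ag -bh gelfandM.
- move=> c g [a [Sa sa ag]]; exists (toC c *: a); split.
  + exact: closed_spanZ.
  + exact: self_adjointZ.
  + by move=> phi; rewrite rmorphM/= -ag gelfandZ.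
- exact: L_limit.
- move=> phi psi /S_separates[s Ss pp]; exists (fun phi => complex.Re (gelfand s phi)).
    exact: Lgen.
  apply/eqP => E; apply: pp.
  have sa := S_self_adjoint Ss.
  by rewrite (gelfand_real phi sa) (gelfand_real psi sa) E.
- move=> phi; have [s Ss s0] := S_nonvanishing phi.
  exists (fun phi => complex.Re (gelfand s phi)); first exact: Lgen.
  apply/eqP => E; apply: s0.
  by rewrite (gelfand_real phi (S_self_adjoint Ss)) E rmorph0.
Qed.

(** A self-adjoint element has the same transform as some element of the closed
    span, hence is equal to it. *)
Lemma closed_span_full : closed_span S = [set: A].
Proof.
have sa_span a : self_adjoint a -> closed_span S a.
  move=> sa; have [|b [Sb sb ab]] := @closed_span_surjective
      (fun phi => complex.Re (gelfand a phi)).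
    exact/Re_continuous/gelfand_continuous.
  suff -> : a = b by [].
  apply: self_adjoint_character_inj => // phi phiP.
  have := ab (SigSub (mem_set phiP)); rewrite -gelfand_real//.
apply/seteqP; split=> // a _; have [b [c [sb sc ->]]] := self_adjoint_span a.
by apply: closed_spanD; [|apply: closed_spanZ]; exact: sa_span.
Qed.

End Density.
End Generated.

(** * Separating families of prescribed cardinality *)

Section SeparatingFamily.
Context {X : topologicalType} {R : realType} {K : Type}.
Variables (x0 : X) (k0 : K) (Phi : K -> X -> R).
Hypothesis X_compact : compact [set: X].
Hypothesis Phi_continuous : forall k, continuous (Phi k).
Hypothesis Phi_separates : forall x y, (forall k, Phi k x = Phi k y) -> x = y.

Let good (F : set (X -> R)) := [/\ F #= [set: K], forall f, F f -> continuous f,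
  forall x y, x <> y -> exists2 f, F f & f x <> f y &
  forall x, exists2 f, F f & f x <> 0].

Let Phi_distinguishes x y : x <> y -> exists k, Phi k x <> Phi k y.
Proof.
move=> xy; apply: contrapT => /forallNP pp.
by apply: xy; apply: Phi_separates => k; apply: contrapT.
Qed.

(** Shifting the coordinates by distinct constants makes them distinct at [x0]
    without spoiling the separation; a large constant makes [Phi k0] positive. *)
Lemma separating_family_countable : countable [set: K] -> exists F, good F.
Proof.
move=> /countable_injP[nu nuinj].
have [M M0 MP] : exists2 M : R, 0 < M & forall x, `|Phi k0 x - Phi k0 x0| <= M.
  apply: (@continuous_compact_bounded X R (fun x => Phi k0 x - Phi k0 x0)) => //.
  by move=> x; apply: cvgB; [exact: Phi_continuous|exact: cvg_cst].
pose Psi k x : R := Phi k x - Phi k x0 + (M + (nu k).+1%:R).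
have Psi_inj : injective Psi.
  move=> k l /(congr1 (fun f => f x0)); rewrite /Psi !subrr !add0r.
  by move=> /addrI/eqP; rewrite eqr_nat => /eqP[] /nuinj; apply; rewrite inE.
exists (range Psi); split.
- by apply: inj_card_eq => k l _ _; exact: Psi_inj.
- move=> _ [k _ <-] x; apply: cvgD; last exact: cvg_cst.
  by apply: cvgB; [exact: Phi_continuous|exact: cvg_cst].
- move=> x y /Phi_distinguishes[k kxy]; exists (Psi k); first by exists k.
  by move=> /addIr/addIr.
- move=> x; exists (Psi k0); first by exists k0.
  apply/eqP; rewrite gt_eqF// /Psi addrA ltr_wpDl ?ltr0n//.
  by have := MP x; rewrite ler_norml => /andP[]; lra.
Qed.

(** Complex functions are pairs of real ones and the infinite cardinal of [C(X, R)]
    is idempotent, so there is a family of [#|K|] distinct continuous real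
    functions. Adding it and the constant [1] to the coordinates gives a set that
    has at least [#|K|] elements and at most [#|K|] times three, that is [#|K|]
    again. *)
Lemma separating_family_infinite : infinite_set [set: K] ->
  [set: K] #<= [set f : X -> Cplx R | continuous f] -> exists F, good F.
Proof.
move=> infK KC; pose V := [set f : X -> R | continuous f].
have [g ginj] : exists g : K -> V, injective g.
  have infV : infinite_set [set: V].
    apply/infiniteP/card_leTT_injP.
    have cstc (n : nat) : V (fun=> n%:R) by move=> x; exact: cvg_cst.
    exists (fun n => SigSub (mem_set (cstc n))) => m n.
    by case=> /(congr1 (fun f => f x0))/eqP; rewrite eqr_nat => /eqP.
  have [pair pair_inj] := square_injects infV.
  have [h hinj] : exists h : K -> [set f : X -> Cplx R | continuous f], injective h.
    by apply/card_leTT_injP; rewrite (card_le_eqr (card_setT _)).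
  have Rec k : V (fun x => complex.Re (set_val (h k) x)).
    by apply: Re_continuous; exact: (set_valP (h k)).
  have Imc k : V (fun x => complex.Im (set_val (h k) x)).
    by apply: Im_continuous; exact: (set_valP (h k)).
  exists (fun k => pair (SigSub (mem_set (Rec k)), SigSub (mem_set (Imc k)))).
  move=> k l /pair_inj[re im]; apply/hinj/val_inj/funext => x.
  have rex := congr1 (fun f => f x) re; have imx := congr1 (fun f => f x) im.
  by apply/eqP; rewrite eq_complex; apply/andP; split; apply/eqP.
have [sq sq_inj] := square_injects infK.
have /infiniteP/card_leTT_injP[e einj] := infK.
pose one : X -> R := fun=> 1.
pose F := [set f | (exists k, f = Phi k) \/ (exists k, f = set_val (g k)) \/ f = one].
exists F; split.
- apply/card_eqPle; split; last first.
    have gK : range (fun k => set_val (g k)) #= [set: K].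
      by apply: inj_card_eq => k l _ _ /val_inj/ginj.
    rewrite -(card_le_eql gK).
    by apply: subset_card_le => _ [k _ <-]; right; left; exists k.
  (* Three values of the second component suffice to enumerate the three parts
     of [F]. *)
  pose u (p : K * K) : X -> R :=
    if pselect (p.2 = e 0%N) then Phi p.1
    else if pselect (p.2 = e 1%N) then set_val (g p.1) else one.
  have Fu : F `<=` range u.
    move=> f [[k ->]|[[k ->]|->]].
    + by exists (k, e 0%N) => //; rewrite /u /=; case: pselect.
    + exists (k, e 1%N) => //; rewrite /u /=; case: pselect => [/einj//|n0] /=.
      by case: pselect.
    + exists (k0, e 2%N) => //; rewrite /u /=; case: pselect => [/einj//|n0] /=.
      by case: pselect => [/einj//|].
  apply: card_le_trans (subset_card_le Fu) _.
  apply: card_le_trans (card_image_le _ _) _.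
  by apply/card_leTT_injP; exists sq.
- move=> f [[k ->]|[[k ->]|->]]; first exact: Phi_continuous.
    exact: (set_valP (g k)).
  by move=> x; exact: cvg_cst.
- by move=> x y /Phi_distinguishes[k kxy]; exists (Phi k) => //; left; exists k.
- move=> x; exists one; first by right; right.
  by apply/eqP; exact: oner_neq0.
Qed.

Lemma separating_family : [set: K] #<= [set f : X -> Cplx R | continuous f] ->
  exists F, good F.
Proof.
have [finK _|infK] := pselect (finite_set [set: K]); last first.
  exact: separating_family_infinite.
exact/separating_family_countable/finite_set_countable.
Qed.

End SeparatingFamily.

(** * Generating sets and embeddings of the spectrum *)

Section Main.
Context {R : realType} (A : comCstarAlgType R).
Local Notation B := (cring A).

(** Two characters that agree on [S] agree on its closed span. *)
Lemma generating_set_embedding (S : set A) : generates S ->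
  embedding_cardinals A (cardinality S).
Proof.
move=> [[s0 Ss0] Ssa Sdense]; exists S; split.
- by apply/eq_cardinality; exact: card_setT_sym.
- by exists (SigSub (mem_set Ss0)).
- apply/(@card_le_trans _ _ _ S); first by rewrite (card_le_eql (card_setT _)).
  apply/card_le_injP.
  exists (fun s => SigSub (mem_set (@gelfand_continuous R A (set_val s)))).
  move=> s t [] /(congr1 (fun f => f _)) st; apply/val_inj.
  apply: self_adjoint_character_inj; [exact/Ssa/set_valP|exact/Ssa/set_valP|].
  by move=> phi phiP; exact: (st (SigSub (mem_set phiP))).
pose Phi (phi : spectrum A) : {ptws S -> R} :=
  fun s => complex.Re (gelfand (set_val s) phi).
exists Phi; apply: compact_embedding.
- exact: spectrum_compact.
- exact/ptws_hausdorff/Rhausdorff.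
- by apply: ptws_continuous => s; exact/Re_continuous/gelfand_continuous.
- move=> phi psi /(congr1 (fun f => f _)) pp.
  apply: spectrum_ext => a.
  have agreeS s : S s -> gelfand s phi = gelfand s psi.
    move=> Ss; rewrite (gelfand_real phi (Ssa _ Ss)) (gelfand_real psi (Ssa _ Ss)).
    by congr toC; exact: (pp (SigSub (mem_set Ss))).
  have agreeP p : products S p -> gelfand p phi = gelfand p psi.
    move=> /productsE[n [s [Ss ->]]].
    apply: (big_ind (fun p : B => gelfand p phi = gelfand p psi)).
    + exact: etrans (gelfand1 phi) (esym (gelfand1 psi)).
    + move=> x y xE yE; apply: etrans (gelfandM x y phi) _.
      by apply: etrans (esym (gelfandM x y psi)); congr (_ * _).
    + by move=> i _; exact: agreeS.
  have agreeL : linear_span (products S) `<=` [set a | gelfand a phi = gelfand a psi].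
    apply: linear_span_ind => //=.
    + by rewrite !gelfand0.
    + by move=> x y xE yE; rewrite !gelfandD xE yE.
    + by move=> k x xE; rewrite !gelfandZ xE.
  have /closureP aS : closure (linear_span (products S)) a by rewrite Sdense.
  apply/eqP; rewrite -subr_eq0; apply/eqP/nrm_eq0/eqP.
  rewrite eq_le nrm_ge0 andbT; apply/ler_addgt0Pr => e e0; rewrite add0r.
  have [|b /agreeL/= bE ab] := aS (e / 2); first by rewrite divr_gt0.
  rewrite (le_trans (nrm_dist _ (gelfand b phi) _))// (splitr e) lerD//.
    by rewrite -gelfandB (le_trans (gelfand_contraction _ _)).
  by rewrite bE -gelfandB (le_trans (gelfand_contraction _ _))// nrmB.
Qed.

Lemma generates_separating (S : set A) : S !=set0 -> S `<=` self_adjoint ->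
  (forall phi psi : spectrum A, phi <> psi ->
     exists2 s, S s & gelfand s phi <> gelfand s psi) ->
  (forall phi : spectrum A, exists2 s, S s & gelfand s phi <> 0) ->
  generates S.
Proof. by move=> S0 Ssa Ssep Snv; split=> //; exact: closed_span_full. Qed.

Lemma self_adjoint_separates (phi psi : spectrum A) : phi <> psi ->
  exists2 s, self_adjoint s & gelfand s phi <> gelfand s psi.
Proof.
move=> pp; apply: contrapT => nsep; apply: pp; apply: spectrum_ext => a.
have agree s : self_adjoint s -> gelfand s phi = gelfand s psi.
  by move=> sa; apply: contrapT => spp; apply: nsep; exists s.
have [b [c [sb sc ->]]] := self_adjoint_span a.
by rewrite !gelfandD !gelfandZ !agree.
Qed.

Lemma self_adjoint_nonvanishing (phi : spectrum A) :
  exists2 s, self_adjoint s & gelfand s phi <> 0.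
Proof.
exists (1 : B); first exact: star1.
by rewrite (gelfand1 phi); apply/eqP; exact: oner_neq0.
Qed.

Lemma generates_self_adjoint : generates (self_adjoint : set A).
Proof.
apply: generates_separating => //; first by exists 0; exact: (star0 A).
  exact: self_adjoint_separates.
exact: self_adjoint_nonvanishing.
Qed.

Lemma gelfand_surjective (f : spectrum A -> R) : continuous f ->
  exists a, self_adjoint a /\ forall phi, gelfand a phi = toC (f phi).
Proof.
move=> /(@closed_span_surjective R A self_adjoint).
case=> //; [exact: self_adjoint_separates|exact: self_adjoint_nonvanishing|].
by move=> a [_ sa af]; exists a.
Qed.

Lemma spectrum_empty_trivial : ~ ([set: spectrum A] !=set0) -> forall a : A, a = 0.
Proof.
move=> X0 a; have sa0 b : self_adjoint b -> b = 0 :> A.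
  move=> sb; apply: self_adjoint_character_inj => //; first exact: (star0 A).
  by move=> phi phiP; case: X0; exists (SigSub (mem_set phiP)).
have [b [c [/sa0-> /sa0-> ->]]] := self_adjoint_span a.
by rewrite scaler0 addr0.
Qed.

(** By Gelfand duality, the self-adjoint elements whose transforms belong to a
    given set of continuous real functions are as many as these functions. *)
Lemma embedding_generating_set (K : Type) (Phi : spectrum A -> {ptws K -> R}) (k0 : K) :
  [set: K] #<= [set f : spectrum A -> Cplx R | continuous f] -> embedding Phi ->
  exists S : set A, generates S /\ S #= [set: K].
Proof.
move=> KC [h [hPhi [hc [g [_ hg _]]]]].
have Phi_c k : continuous (fun phi => Phi phi k).
  have Phic : continuous Phi.
    move=> phi; rewrite (_ : Phi = set_val \o h); last first.
      by apply/funext => psi; rewrite /= hPhi.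
    apply: continuous_comp; first exact: hc.
    exact: set_val_continuous.
  move=> phi; apply: (@continuous_comp _ _ _ Phi (fun f : {ptws K -> R} => f k)).
    exact: Phic.
  exact: ptws_eval_continuous.
have Phi_sep phi psi : (forall k, Phi phi k = Phi psi k) -> phi = psi.
  move=> pp; apply: (can_inj hg); apply: val_inj; rewrite -[LHS]/(set_val (h phi)).
  by rewrite -[RHS]/(set_val (h psi)) !hPhi; exact/funext.
have [[phi0 _]|X0] := pselect ([set: spectrum A] !=set0); last first.
  (* Then [C(D)] has a single element, and so does [K]. *)
  have A0 := spectrum_empty_trivial X0.
  exists [set 0]; split.
    split; first by exists 0.
      by move=> _ ->; exact: (star0 A).
    apply/seteqP; split=> // a _; rewrite (A0 a).
    exact/subset_closure/linear_span0.
  have -> : [set: K] = [set k0].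
    apply/seteqP; split=> // k _ /=.
    have /card_leTT_injP[j jinj] : [set: K] #<=
        [set: [set f : spectrum A -> Cplx R | continuous f]].
      by rewrite (card_le_eqr (card_setT _)).
    apply: jinj; apply/val_inj/funext => phi; by case: X0; exists phi.
  exact: eq_card1.
have [F [FK Fc Fsep Fnv]] :=
  separating_family phi0 k0 (@spectrum_compact R A) Phi_c Phi_sep KC.
pose re (a : A) (phi : spectrum A) : R := complex.Re (gelfand a phi).
pose S := [set a : A | self_adjoint a /\ F (re a)].
have lift f : F f -> exists2 a, S a & forall phi, gelfand a phi = toC (f phi).
  move=> Ff; have [a [sa af]] := gelfand_surjective (Fc f Ff).
  exists a => //; split=> //; rewrite (_ : re a = f)//.
  by apply/funext => phi; rewrite /re af.
exists S; split.
  apply: generates_separating; last 2 first.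
  - move=> phi psi /Fsep[f /lift[a Sa af] fpp]; exists a => //.
    by rewrite !af => /toC_inj.
  - move=> phi; have [f /lift[a Sa af] f0] := Fnv phi; exists a => //.
    by rewrite af -(rmorph0 toC) => /toC_inj.
  - have [f /lift[a Sa _] _] := Fnv phi0; by exists a.
  - by move=> a [].
apply: card_eq_trans FK.
have <- : re @` S = F.
  apply/seteqP; split=> [_ [a [_ Fa] <-]//|f Ff].
  have [a Sa af] := lift f Ff; exists a => //.
  by apply/funext => phi; rewrite /re af.
rewrite card_eq_sym; apply: inj_card_eq => a b.
rewrite !inE => -[sa _] [sb _] ab; apply: self_adjoint_character_inj => // phi phiP.
pose psi : spectrum A := SigSub (mem_set phiP).
have : toC (re a psi) = toC (re b psi) by rewrite ab.
by rewrite /re -!gelfand_real.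
Qed.

Lemma GC_embedding_cardinals : GC A = embedding_cardinals A.
Proof.
apply/funext => k; apply/propext; split.
  by move=> [S [gS ->]]; exact: generating_set_embedding.
move=> [K [-> [k0 _] KC [Phi ePhi]]].
have [S [gS SK]] := embedding_generating_set k0 KC ePhi.
by exists S; split=> //; apply/eq_cardinality; rewrite card_eq_sym.
Qed.

Lemma GC_has_least : exists k, is_least (GC A) k.
Proof.
have [[S gS] Smin] := @least_type_exists {S : set A | generates S} (fun S => sval S)
  (inhabits (exist _ _ generates_self_adjoint)).
exists (cardinality S); split; first by exists S.
move=> l [S' [gS' ->]]; exists S, S'; split.
- by apply/eq_cardinality; exact: card_setT_sym.
- by apply/eq_cardinality; exact: card_setT_sym.
- by apply/card_leTT_injP; exact: (Smin (exist _ S' gS')).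
Qed.

End Main.

Theorem theorem3p9 (R : realType) (A : comCstarAlgType R) :
  GC A = embedding_cardinals A /\ is_least (embedding_cardinals A) (gen A).
Proof.
rewrite -GC_embedding_cardinals; split=> //.
rewrite /gen /min_cardinal; case: pselect => [e|]; first by case: cid.
by move=> /(_ (GC_has_least A)).
Qed.
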